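(* Let $d\ge1$ and $\lambda'>\lambda>0$. Let $X$ be a homogeneous Poisson point process on $\mathbb{R}^d$ with intensity $\lambda$ and law $P$. There does not exist a translation-equivariant monotone measurable mapping $\phi:\mathbb{M}\to\mathbb{M}$ such that $\phi(X)$ is a homogeneous Poisson point process on $\mathbb{R}^d$ with intensity $\lambda'$, and $\phi$ is strongly finitary with respect to $P$.
   Context: $\mathbb{M}$ denotes the space of all Borel simple point measures on $\mathbb{R}^d$ (measures of the form $\sum_{x\in S}\delta_x$ with $S\subset\mathbb{R}^d$ locally finite), equipped with the smallest $\sigma$-field making all the maps $\mu\mapsto\mu(B)$, $B\subset\mathbb{R}^d$ Borel, measurable. Point processes are random variables with values in $\mathbb{M}$. For an isometry $\theta$ of $\mathbb{R}^d$ and $\mu\in\mathbb{M}$, $\theta(\mu)(A)=\mu(\theta^{-1}(A))$. A mapping $\phi:\mathbb{M}\to\mathbb{M}$ is translation-equivariant if $\theta(\phi(\mu))=\phi(\theta(\mu))$ for all $\mu\in\mathbb{M}$ and all translations $\theta$ of $\mathbb{R}^d$. Write $\mu_1\le\mu_2$ if $\mu_1(A)\le\mu_2(A)$ for all Borel $A$. A mapping $\phi$ is monotone if either $\phi(\mu)\le\mu$ for all $\mu\in\mathbb{M}$, or $\mu\le\phi(\mu)$ for all $\mu\in\mathbb{M}$. For $\mu\in\mathbb{M}$ and Borel $A$, $\mu|_A(\cdot)=\mu(\cdot\cap A)$. $B(x,r)=\{y\in\mathbb{R}^d:\|x-y\|<r\}$ with the Euclidean norm, and $\mathbf{0}$ is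 the origin. A translation-equivariant measurable mapping $\phi:\mathbb{M}\to\mathbb{M}$ is strongly finitary with respect to $P$ if for $P$-a.e. $\mu\in\mathbb{M}$ there exists a positive real number $n=n(\mu)$ such that for $P$-a.e. $\mu'\in\mathbb{M}$ we have $\phi(\mu)|_{B(\mathbf{0},1)}=\phi(\mu')|_{B(\mathbf{0},1)}$ whenever $\mu|_{B(\mathbf{0},n)}=\mu'|_{B(\mathbf{0},n)}$. *)

(* Defs.v *)
From HB Require Import structures.
From mathcomp Require Import all_boot all_order all_algebra.
From mathcomp Require Import all_classical all_reals all_analysis.
From mathcomp Require Import measurable_realfun.

Set Implicit Arguments.
Unset Strict Implicit.
Unset Printing Implicit Defensive.

Import Order.TTheory GRing.Theory Num.Theory.
Import numFieldNormedType.Exports.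

Local Open Scope classical_set_scope.
Local Open Scope ring_scope.

(* Borel sigma-field of R^d.  The library topology on ['rV[R]_d] comes from the
   max norm, which has the same open and bounded sets as the Euclidean norm. *)
HB.instance Definition _ (R : realType) (d : nat) :=
  @isMeasurable.Build (sigma_display (@open 'rV[R]_d)) 'rV[R]_d
    <<s @open 'rV[R]_d >>
    (@sigma_algebra0 _ setT (@open 'rV[R]_d))
    (@sigma_algebraC _ (@open 'rV[R]_d))
    (@sigma_algebra_bigcup _ setT (@open 'rV[R]_d)).

Section euclidean_space.
Context {R : realType}.

Definition enorm (d : nat) (x : 'rV[R]_d) : R :=
  Num.sqrt (\sum_(i < d) x ord0 i ^+ 2).

Definition eball (d : nat) (x : 'rV[R]_d) (r : R) : set 'rV[R]_d :=
  [set y | enorm (x - y) < r].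

Definition slice (d : nat) (A : set 'rV[R]_d.+1) (t : R) : set 'rV[R]_d :=
  [set v | A (row_mx (const_mx t : 'rV[R]_1) v)].

(* Lebesgue measure on R^d as the d-fold product of the one-dimensional one:
   integrate over the first coordinate t the volume of the section at t.
   Meaningful on Borel sets only. *)
Fixpoint vol (d : nat) : set 'rV[R]_d -> \bar R :=
  match d with
  | 0%N => fun A => \d_(0 : 'rV[R]_0) A
  | d'.+1 => fun A => (\int[lebesgue_measure]_t vol (slice A t))%E
  end.

Lemma vol_set0 (d : nat) : vol (set0 : set 'rV[R]_d) = 0%E.
Proof.
elim: d => [|d IH] /=; first by rewrite diracE in_set0.
by apply: integral0_eq => t _; rewrite -[RHS]IH; congr vol.
Qed.

Lemma vol_box (d : nat) (a b : 'rV[R]_d) :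
  (forall i, a ord0 i <= b ord0 i) ->
  vol [set x : 'rV[R]_d | forall i, a ord0 i <= x ord0 i <= b ord0 i] =
  (\prod_(i < d) (b ord0 i - a ord0 i))%:E.
Proof.
elim: d a b => [|d IH] a b ab.
  by rewrite big_ord0 /= diracE mem_set//= => -[].
rewrite big_ord_recl /=.
pose a' : 'rV[R]_d := \row_i a ord0 (lift ord0 i).
pose b' : 'rV[R]_d := \row_i b ord0 (lift ord0 i).
pose c := \prod_(i < d) (b ord0 (lift ord0 i) - a ord0 (lift ord0 i)).
have c0 : 0 <= c by apply: prodr_ge0 => i _; rewrite subr_ge0.
have rmx0 (t : R) (v : 'rV[R]_d) :
    row_mx (const_mx t : 'rV[R]_1) v ord0 (ord0 : 'I_(1 + d)) = t.
  have {2}<- : (const_mx t : 'rV[R]_1) ord0 ord0 = t by rewrite mxE.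
  rewrite -[RHS](row_mxEl _ v).
  by congr (row_mx _ _ _ _); exact/val_inj.
have rmxS (t : R) (v : 'rV[R]_d) (i : 'I_d) :
    row_mx (const_mx t : 'rV[R]_1) v ord0 (lift ord0 i : 'I_(1 + d)) = v ord0 i.
  rewrite -[RHS](row_mxEr (const_mx t : 'rV[R]_1) v).
  by congr (row_mx _ _ _ _); exact/val_inj.
transitivity (\int[lebesgue_measure]_t
    (c%:E * (\1_`[a ord0 ord0, b ord0 ord0] t)%:E))%E.
  apply: eq_integral => t _; rewrite indicE.
  case: (boolP (t \in _)) => [|tn]; rewrite ?inE/=.
    rewrite in_itv /= => tab; rewrite mule1.
    have -> : c = \prod_(i < d) (b' ord0 i - a' ord0 i).
      by apply: eq_bigr => i _; rewrite !mxE.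
    rewrite -IH; last by move=> i; rewrite !mxE.
    congr vol; apply/seteqP; split => v /= H i.
      by rewrite !mxE; have := H (lift ord0 i); rewrite rmxS.
    case: (unliftP ord0 i) => [j|] ->; last by rewrite rmx0.
    by rewrite rmxS; have := H j; rewrite !mxE.
  rewrite mule0 -(vol_set0 d); congr vol; apply/seteqP; split => v //= H.
  move: tn; rewrite notin_setE/= in_itv/=.
  by have := H ord0; rewrite rmx0.
rewrite ge0_integralZl_EFin//; last first.
  apply/measurable_EFinP; exact: measurable_indic.
rewrite integral_indic// setIT /= lebesgue_measure_itv /= lte_fin.
case: ltP => [_|ba]; first by rewrite -EFinB -EFinM mulrC.
have -> : b ord0 ord0 - a ord0 ord0 = 0.
  by apply/eqP; rewrite subr_eq0 eq_le ab ba.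
by rewrite mul0r mule0.
Qed.

Lemma measurable_translation (d : nat) (t : 'rV[R]_d) :
  measurable_fun setT (fun x : 'rV[R]_d => x + t).
Proof.
apply: (@measurability _ _ _ _ _ _ (@open 'rV[R]_d)) => //.
move=> _ [B oB <-]; rewrite setTI; apply: sub_sigma_algebra.
have addt (V : normedModType R) (u : V) : continuous (fun x : V => x + u).
  by move=> x; apply: cvgD; [exact: cvg_id|exact: cvg_cst].
by have /continuousP := addt 'rV[R]_d t; exact.
Qed.

End euclidean_space.

Section point_measures.
Context (R : realType) (d : nat).
Implicit Types (t : 'rV[R]_d).

Definition locally_finite (S : set 'rV[R]_d) : Prop :=
  forall B : set 'rV[R]_d, bounded_set B -> finite_set (S `&` B).

(* A library measure is a function on all subsets, of which only the values on
   measurable sets matter.  Asking for the formula on every subset makes a point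
   measure determined by its values on Borel sets (point_measure_ext), so that
   Leibniz equality is equality of Borel measures. *)
Record point_measure := PointMeasure {
  point_measure_val :> {measure set 'rV[R]_d -> \bar R} ;
  point_measureP : exists2 S : set 'rV[R]_d, locally_finite S &
    forall A : set 'rV[R]_d, point_measure_val A = \esum_(x in S) \d_x A }.

Lemma point_measure_eq (mu nu : point_measure) :
  (forall A : set 'rV[R]_d, mu A = nu A) -> mu = nu.
Proof.
case: mu nu => [mu Pmu] [nu Pnu] /= mn.
have e : mu = nu by apply: eq_measure; apply/funext.
by case: nu / e Pnu {mn} => Pnu; rewrite (Prop_irrelevance Pmu Pnu).
Qed.

Lemma closed_measurable_rV (A : set 'rV[R]_d) : closed A -> measurable A.
Proof.
move=> cA; rewrite -[A]setCK; apply: measurableC.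
by apply: sub_sigma_algebra; exact: closed_openC.
Qed.

Lemma esum_dirac1 (S : set 'rV[R]_d) t :
  \esum_(x in S) \d_x [set t] = (\1_S t)%:E :> \bar R.
Proof.
rewrite indicE; case: (boolP (t \in S)) => [|]; rewrite ?notin_setE ?inE => tS.
  rewrite (esumID [set t]) => [|x _]; last exact: measure_ge0.
  rewrite [X in (X + _)%E](_ : _ = \esum_(x in [set t]) \d_x [set t]); last first.
    by congr esum; apply/seteqP; split => x /= [] // -> .
  rewrite esum_set1 ?measure_ge0// [X in (_ + X)%E]esum1 ?adde0 => [|x [_ /= xt]].
    by rewrite diracE mem_set.
  by rewrite diracE memNset.
apply: esum1 => x Sx; rewrite diracE memNset// => /= xt.
by apply: tS; rewrite -xt.
Qed.

Lemma point_measure_ext (mu nu : point_measure) :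
  (forall A : set 'rV[R]_d, measurable A -> mu A = nu A) -> mu = nu.
Proof.
move=> mn; apply: point_measure_eq => A.
have [S _ muE] := point_measureP mu; have [S' _ nuE] := point_measureP nu.
rewrite muE nuE; congr esum; apply/funext => t; apply/propext.
have /mn : measurable [set t].
  by apply: closed_measurable_rV; apply: accessible_closed_set1; exact: hausdorff_accessible.
rewrite muE nuE !esum_dirac1 !indicE => -[] /eqP; rewrite eqr_nat.
case: (boolP (t \in S)) => tS; case: (boolP (t \in S')) => tS' //= _.
  by split=> _; exact/set_mem.
by split=> /mem_set; rewrite ?(negbTE tS) ?(negbTE tS').
Qed.

Lemma locally_finite_translate t (S : set 'rV[R]_d) :
  locally_finite S -> locally_finite [set x + t | x in S].
Proof.
move=> fS B bB.
have /fS fin : bounded_set [set x - t | x in B].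
  have [M [Mreal MB]] := bB.
  exists (M + `|t|); split; first by rewrite realD.
  move=> N MN _ [x Bx <-] /=.
  rewrite (le_trans (ler_normB _ _))// -lerBrDr; apply: MB => //.
  by rewrite ltrBrDr.
apply: sub_finite_set (finite_image (fun x => x + t) fin).
move=> _ [[x Sx <-] Bx]; exists x => //; split=> //.
by exists (x + t) => //; rewrite addrK.
Qed.

Section translation.
Variables (t : 'rV[R]_d) (mu : point_measure).

Definition translate_measure : set 'rV[R]_d -> \bar R := pushforward mu (fun x => x + t).

Let nu0 : translate_measure set0 = 0%E.
Proof. by rewrite /translate_measure /pushforward preimage_set0 measure0. Qed.

Let nu_ge0 A : (0 <= translate_measure A)%E.
Proof. by rewrite /translate_measure /pushforward measure_ge0. Qed.

Let nu_sigma_additive : semi_sigma_additive translate_measure.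
Proof.
move=> F mF tF mUF; rewrite /translate_measure /pushforward preimage_bigcup.
have mt A : measurable A -> measurable ((fun x : 'rV[R]_d => x + t) @^-1` A).
  by move=> mA; rewrite -[X in measurable X]setTI; exact: measurable_translation.
apply: measure_semi_sigma_additive.
- by move=> n; exact: mt.
- apply/trivIsetP => /= i j _ _ ij; rewrite -preimage_setI.
  by move/trivIsetP : tF => /(_ _ _ _ _ ij) ->//; rewrite preimage_set0.
- by rewrite -preimage_bigcup; exact: mt.
Qed.

HB.instance Definition _ := isMeasure.Build _ _ _ translate_measure
  nu0 nu_ge0 nu_sigma_additive.

Let nuP : exists2 S : set 'rV[R]_d, locally_finite S &
  forall A : set 'rV[R]_d, (translate_measure : {measure set _ -> \bar R}) A = \esum_(x in S) \d_x A.
Proof.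
have [S fS muE] := point_measureP mu.
exists [set x + t | x in S]; first exact: locally_finite_translate.
move=> A; rewrite /= /translate_measure /pushforward muE.
rewrite esum_image; last by move=> x y _ _; exact: addIr.
by apply: eq_esum => x _; rewrite !diracE.
Qed.

Definition translate : point_measure := PointMeasure nuP.

Lemma translateE A : translate A = pushforward mu (fun x => x + t) A.
Proof. by []. Qed.

End translation.

Let zeroP : exists2 S : set 'rV[R]_d, locally_finite S &
  forall A : set 'rV[R]_d,
    (mzero : {measure set 'rV[R]_d -> \bar R}) A = \esum_(x in S) \d_x A.
Proof.
exists set0; first by move=> B _; rewrite set0I; exact: finite_set0.
by move=> A; rewrite esum_set0.
Qed.

HB.instance Definition _ := gen_eqMixin point_measure.
HB.instance Definition _ := gen_choiceMixin point_measure.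
HB.instance Definition _ := isPointed.Build point_measure (PointMeasure zeroP).

Definition evaluation_sets : set (set point_measure) :=
  \bigcup_(B in [set B : set 'rV[R]_d | measurable B])
    preimage_set_system setT (fun mu : point_measure => mu B) measurable.

HB.instance Definition _ :=
  @isMeasurable.Build (sigma_display evaluation_sets) point_measure
    <<s evaluation_sets >>
    (@sigma_algebra0 _ setT evaluation_sets)
    (@sigma_algebraC _ evaluation_sets)
    (@sigma_algebra_bigcup _ setT evaluation_sets).

Lemma measurable_evaluation (B : set 'rV[R]_d) :
  measurable B -> measurable_fun setT (fun mu : point_measure => mu B).
Proof.
move=> mB _ C mC; apply: sub_sigma_algebra.
by exists B => //; exists C.
Qed.

Definition le_measure (mu nu : point_measure) : Prop :=
  forall A : set 'rV[R]_d, measurable A -> (mu A <= nu A)%E.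

Definition agree_on (D : set 'rV[R]_d) (mu nu : point_measure) : Prop :=
  forall A : set 'rV[R]_d, measurable A -> mu (A `&` D) = nu (A `&` D).

Definition translation_equivariant (phi : point_measure -> point_measure) :=
  forall (t : 'rV[R]_d) (mu : point_measure),
    translate t (phi mu) = phi (translate t mu).

Definition monotone_map (phi : point_measure -> point_measure) : Prop :=
  (forall mu, le_measure (phi mu) mu) \/ (forall mu, le_measure mu (phi mu)).

Definition strongly_finitary (P : probability point_measure R)
    (phi : point_measure -> point_measure) : Prop :=
  {ae P, forall mu, exists2 n : R, 0 < n &
    {ae P, forall mu', agree_on (eball 0 n) mu mu' ->
                       agree_on (eball 0 1) (phi mu) (phi mu')}}.

End point_measures.

Section poisson_process.
Context (R : realType) (d : nat) (disp : measure_display)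
  (Omega : measurableType disp) (Pr : probability Omega R).

(* Taking some of the [C i] equal to [setT] gives the product rule for
   subfamilies. *)
Definition independent (I : finType) (Z : I -> Omega -> \bar R) : Prop :=
  forall C : I -> set (\bar R), (forall i, measurable (C i)) ->
    Pr (\bigcap_i (Z i @^-1` C i)) = (\prod_(i : I) Pr (Z i @^-1` C i))%E.

(* The second argument of [poisson_prob] is a dummy; for rate 0 it is the Dirac
   mass at 0.  A Poisson variable of infinite mean is almost surely infinite. *)
Definition homogeneous_poisson (lambda : R) (X : Omega -> point_measure R d) :=
  [/\ (forall B : set 'rV[R]_d, measurable B -> (vol B < +oo)%E ->
        forall k : nat, Pr [set w | X w B = k%:R%:E] =
                        poisson_prob (lambda * fine (vol B)) 0 [set k]),
      (forall B : set 'rV[R]_d, measurable B -> vol B = +oo%E ->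
        Pr [set w | X w B = +oo%E] = 1%E)
    & forall (n : nat) (B : 'I_n -> set 'rV[R]_d),
        (forall i, measurable (B i)) -> trivIset setT B ->
        independent (fun i w => X w (B i))].

End poisson_process.

(* Main.v *)
Require Import Defs.
From HB Require Import structures.
From mathcomp Require Import all_boot all_order all_algebra.
From mathcomp Require Import all_classical all_reals all_analysis.
From mathcomp Require Import measurable_realfun ring lra zify.

(** Cut R^d into blocks of side delta, put q := delta^d and Y := phi X, and call
    a block new when X misses it and Y does not; this has probability
    p = exp(- lambda q) - exp(- lambda' q), of order q.  The event that a given
    block is new is approximately determined by which cells of a much finer grid
    X occupies in a finite window.  So, up to a small proportion of errors, the
    fine occupation pattern a of X predicts the list W(a) of new blocks of a
    large box, while by X <= Y the pair of patterns (a, b) of X and Y has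
    probability at most the Bernoulli weight of b.  Given a, a Bernoulli pattern
    b >= a has an extra occupied cell in a block of W(a) with probability only
    about lambda' q, so each correct prediction gains a factor 1/q.  Comparing
    relative entropies per block gives
      ln (1/q) p <= C p + C q
    with C independent of delta, which fails as delta tends to 0. *)

Set Implicit Arguments.
Unset Strict Implicit.
Unset Printing Implicit Defensive.

Import Order.TTheory GRing.Theory Num.Theory.
Import numFieldNormedType.Exports.
Local Open Scope classical_set_scope.
Local Open Scope ring_scope.

(** * Probabilities of finite unions and covers *)

Lemma measure_bigcup_finType (dd : measure_display) (T : measurableType dd)
    (R : realType) (mu : {measure set T -> \bar R}) (I : finType)
    (F : I -> set T) :
  (forall i, measurable (F i)) -> trivIset setT F ->
  mu (\bigcup_i F i) = (\sum_i mu (F i))%E.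
Proof.
move=> mF tF; rewrite measure_fin_bigcup//; last exact: finite_finset.
rewrite (fsbig_seq _ (fun i => mu (F i)) (index_enum_uniq I)).
by congr (\big[_/_]_(i \in _) _); apply/seteqP; split => i //= _; rewrite mem_index_enum.
Qed.

Lemma measure_fin_valued (dd : measure_display) (T : measurableType dd)
    (R : realType) (mu : {measure set T -> \bar R}) (F : finType)
    (v : T -> F) (S : pred F) :
  (forall b, measurable (v @^-1` [set b])) ->
  mu [set w | S (v w)] = (\sum_(b | S b) mu (v @^-1` [set b]))%E.
Proof.
move=> mv; rewrite big_mkcond /=.
rewrite (eq_bigr (fun b => mu (if S b then v @^-1` [set b] else set0))); last first.
  by move=> b _; case: ifP; rewrite ?measure0.
rewrite -measure_bigcup_finType.
- congr (mu _); apply/seteqP; split => w /=.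
    by move=> Sw; exists (v w); rewrite ?Sw.
  by move=> [b _]; case: ifP => //= Sb ->.
- by move=> b; case: ifP.
- move=> a b _ _ [w []]; case: ifP => // _ <-.
  by case: ifP => // _ <-.
Qed.

Lemma fine_le_sum_cover (dd : measure_display) (T : measurableType dd)
    (R : realType) (P : probability T R) (I : finType) (A : set T) (F : I -> set T) :
  measurable A -> (forall i, measurable (F i)) -> A `<=` \bigcup_i F i ->
  fine (P A) <= \sum_i fine (P (F i)).
Proof.
move=> mA mF AF; rewrite -lee_fin fineK ?fin_num_measure// -sumEFin.
under eq_bigr do rewrite fineK ?fin_num_measure//.
have := @content_sub_fsum _ _ _ P I setT A F.
rewrite (fsbig_seq _ (fun i => P (F i)) (index_enum_uniq I)).
rewrite (_ : [set` index_enum I] = setT); last first.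
  by apply/seteqP; split => // i _ /=; rewrite mem_index_enum.
by apply => //; exact: finite_finset.
Qed.

Lemma fine_le_setU (dd : measure_display) (T : measurableType dd)
    (R : realType) (P : probability T R) (A B C : set T) :
  measurable A -> measurable B -> measurable C -> A `<=` B `|` C ->
  fine (P A) <= fine (P B) + fine (P C).
Proof.
move=> mA mB mC ABC; rewrite -lee_fin EFinD !fineK ?fin_num_measure//.
apply: (le_trans _ (measureU2 _ mB mC)); apply: le_measure => //; rewrite inE//.
exact: measurableU.
Qed.

(** * Exponential change of measure *)

Lemma sum_ffun_bool_prod (R : comPzSemiRingType) (C : finType)
    (f : C -> bool -> R) :
  \sum_(b : {ffun C -> bool}) \prod_c f c (b c) =
  \prod_c (f c true + f c false).
Proof.
rewrite -bigA_distr_bigA; apply: eq_bigr => c _.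
by rewrite (bigD1 true) //= (bigD1 false) //= big1 ?addr0// => -[].
Qed.

Definition bernoulli_weight (R : realType) (C : finType) (rho : R)
    (b : {ffun C -> bool}) : R :=
  \prod_c (if b c then rho else 1 - rho).

Lemma prod_le_expR (R : realType) (C : finType) (x : R) :
  0 <= x -> (1 + x) ^+ #|C| <= expR (#|C|%:R * x).
Proof.
move=> x0; rewrite mulrC expRM_natr lerXn2r ?nnegrE ?expR_ge0 ?addr_ge0//.
exact: expR_ge1Dx.
Qed.

(* Since e^u >= 1 + u, it suffices to bound an exponential moment; for fixed a the
   sum over b >= a factors over the cells, each factor is at most rho or 1
   according to a c, and the sum over a is then at most (1 + rho)^#|C|. *)
Lemma domination_bound (R : realType) (C : finType) (rho t : R)
    (w : {ffun C -> bool} -> C -> bool)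
    (p : {ffun C -> bool} -> {ffun C -> bool} -> R) :
  0 <= rho <= 1 -> 1 <= t ->
  (forall a b, 0 <= p a b) ->
  \sum_a \sum_b p a b = 1 ->
  (forall a b : {ffun C -> bool}, (exists c, a c && ~~ b c) -> p a b = 0) ->
  (forall a b, p a b <= bernoulli_weight rho b) ->
  \sum_(a : {ffun C -> bool}) \sum_(b : {ffun C -> bool}) p a b * \sum_c
     (ln t *+ [&& ~~ a c, b c & w a c] - t * rho *+ w a c) <= #|C|%:R * rho.
Proof.
move=> /andP[r0 r1] t1 p0 p1 pab pb.
have t0 : 0 < t by rewrite (lt_le_trans ltr01).
(* The log-weight [g] earns [ln t] for each correctly predicted new cell and pays [t * rho] for each
   prediction, correct or not. *)
pose g (a b : {ffun C -> bool}) : R := \sum_c (ln t *+ [&& ~~ a c, b c & w a c] - t * rho *+ w a c).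
pose K : R := #|C|%:R * rho.
have gE (a b : {ffun C -> bool}) : expR (g a b) =
    \prod_c ((if [&& ~~ a c, b c & w a c] then t else 1) *
             (if w a c then expR (- (t * rho)) else 1)).
  rewrite /g (big_morph expR (@expRD R) (@expR0 R)).
  apply: eq_bigr => c _; rewrite expRD.
  congr (_ * _); first by case: ifP => _; rewrite ?mulr1n ?lnK ?mulr0n ?expR0 ?posrE.
  by case: ifP => _; rewrite ?mulr1n ?mulr0n ?oppr0 ?expR0.
have sumE : \sum_a \sum_b p a b * expR (g a b) <= expR K.
  apply: (le_trans _ (prod_le_expR C r0)).
  rewrite -prodr_const.
  under [leRHS]eq_bigr do rewrite addrC.
  rewrite -(sum_ffun_bool_prod (fun (_ : C) (e : bool) => if e then rho else 1)).
  apply: ler_sum => a _.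
  (* One cell's share of the Bernoulli weight, set to 0 when it violates b >= a, times its share of
     e^g. *)
  pose F c (e : bool) : R := (if a c && ~~ e then 0 else if e then rho else 1 - rho)
     * ((if [&& ~~ a c, e & w a c] then t else 1) *
             (if w a c then expR (- (t * rho)) else 1)).
  have F0 c e : 0 <= F c e.
    by rewrite /F !mulr_ge0//; repeat case: ifP => _;
       rewrite ?expR_ge0 ?subr_ge0 // ltW.
  have : \sum_b p a b * expR (g a b) <= \sum_(b : {ffun C -> bool}) \prod_c F c (b c).
    apply: ler_sum => b _; rewrite gE.
    have [/existsP[c abc]|/existsPn nab] := boolP [exists c, a c && ~~ b c].
      rewrite pab ?mul0r; last by exists c.
      by apply: prodr_ge0.
    rewrite /F [leRHS]big_split /= ler_wpM2r//.
      by apply: prodr_ge0 => c _; rewrite mulr_ge0//; case: ifP => _ //;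
        rewrite ?expR_ge0// ltW.
    rewrite (le_trans (pb a b))// /bernoulli_weight.
    by under [leRHS]eq_bigr => c _ do rewrite (negbTE (nab c)).
  move=> /le_trans; apply; rewrite sum_ffun_bool_prod.
  apply: ler_prod => c _; rewrite addr_ge0//= /F.
  case: (a c) => /=.
    rewrite mul0r addr0 mul1r; case: ifP => _; rewrite ?mulr1//.
    by rewrite ler_piMr// -expR0 ler_expR oppr_le0 mulr_ge0// ltW.
  (* An empty predicted cell contributes (t rho + 1 - rho) e^(- t rho), which is at most 1 because 1
     + t rho <= e^(t rho). The penalty in [g] is chosen for this. *)
  case: (w a c) => /=; last by rewrite !mulr1 addrC subrK.
  rewrite mul1r mulrA -mulrDl expRN ler_pdivrMr ?expR_gt0// mul1r.
  apply: (le_trans _ (expR_ge1Dx _)).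
  by rewrite addrC (mulrC rho) lerD2r gerBl.
(* Convexity enters as e^u >= 1 + u with u = g - K, averaged under [p]. *)
have : \sum_a \sum_b p a b * (g a b + (1 - K)) <= 1.
  apply: (@le_trans _ _ (\sum_a \sum_b p a b * expR (g a b) * expR (- K))).
    apply: ler_sum => a _; apply: ler_sum => b _.
    rewrite -mulrA -expRD ler_wpM2l// addrCA; exact: expR_ge1Dx.
  under eq_bigr do rewrite -mulr_suml.
  by rewrite -mulr_suml expRN ler_pdivrMr ?expR_gt0// mul1r.
under eq_bigr => a _.
  under eq_bigr => b _ do rewrite mulrDr.
  rewrite big_split /= -mulr_suml; over.
by rewrite big_split /= -mulr_suml p1 mul1r addrCA gerDl subr_le0.
Qed.

Section domination.
Context (R : realType) (dd : measure_display) (Omega : measurableType dd)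
  (Pr : probability Omega R) (C : finType).
Variables (rho t : R) (w : {ffun C -> bool} -> C -> bool)
  (x y : Omega -> {ffun C -> bool}).
Hypotheses (rho_itv : 0 <= rho <= 1) (t1 : 1 <= t).
Hypotheses (mx : forall c, measurable [set o | x o c])
  (my : forall c, measurable [set o | y o c]).
Hypothesis xy : forall o c, x o c -> y o c.
Hypothesis y_law : forall b, Pr [set o | y o = b] = (bernoulli_weight rho b)%:E.

Lemma measurable_ffun_fiber (v : Omega -> {ffun C -> bool}) b :
  (forall c, measurable [set o | v o c]) -> measurable [set o | v o = b].
Proof.
move=> mv; rewrite (_ : [set _ | _] = \bigcap_(c in [set: C]) [set o | v o c = b c]).
  apply: fin_bigcap_measurable => // c _; case: (b c); first exact: mv.
  rewrite (_ : [set _ | _] = ~` [set o | v o c]); first exact: measurableC.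
  by apply/seteqP; split => o /=; [move=> ->|move=> /negP/negbTE].
apply/seteqP; split => o /=; first by move=> <- c _.
by move=> H; apply/ffunP => c; exact: H.
Qed.

Let v o := (x o, y o).

Let mv ab : measurable (v @^-1` [set ab]).
Proof.
case: ab => a b; rewrite (_ : _ @^-1` _ = [set o | x o = a] `&` [set o | y o = b]).
  by apply: measurableI; exact: measurable_ffun_fiber.
by apply/seteqP; split => o /= -[xa yb]; rewrite /v ?xa ?yb.
Qed.

Lemma measurable_ffun_pred (S : pred ({ffun C -> bool} * {ffun C -> bool})) :
  measurable [set o | S (x o, y o)].
Proof.
rewrite (_ : [set _ | _] = \bigcup_(ab in [set ab | S ab]) v @^-1` [set ab]).
  by apply: fin_bigcup_measurable.
apply/seteqP; split => o /=; first by move=> So; exists (x o, y o).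
by move=> [ab Sab vab]; move: Sab; rewrite /= -vab.
Qed.

(** The joint law of [(x, y)] fits [domination_bound]: it charges only pairs with x <= y, and each
    atom is at most the corresponding atom of the law of [y]. Here [w] is a predictor that sees only
    the pattern [x]; the law of [x] may be arbitrary. *)
Lemma probability_domination :
  \sum_c (ln t * fine (Pr [set o | [&& ~~ x o c, y o c & w (x o) c]])
          - t * rho * fine (Pr [set o | w (x o) c])) <= #|C|%:R * rho.
Proof.
pose p a b := fine (Pr (v @^-1` [set (a, b)])).
have pE a b : Pr (v @^-1` [set (a, b)]) = (p a b)%:E.
  by rewrite fineK// fin_num_measure.
have p_sum (S : pred ({ffun C -> bool} * {ffun C -> bool})) :
    \sum_a \sum_b p a b *+ S (a, b) = fine (Pr [set o | S (x o, y o)]).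
  have := measure_fin_valued Pr S mv; rewrite /v => ->.
  rewrite (eq_bigr (fun ab => (p ab.1 ab.2)%:E)); last by case=> a b _; rewrite -pE.
  rewrite sumEFin /= pair_bigA/= [RHS]big_mkcond/=.
  by apply: eq_bigr => -[a b] _; rewrite mulrb.
have := @domination_bound R C rho t w p rho_itv t1.
have p0 a b : 0 <= p a b by rewrite fine_ge0.
have p1 : \sum_a \sum_b p a b = 1.
  have := p_sum predT; rewrite (_ : [set o | _] = setT) ?probability_setT//=.
  by apply/seteqP.
have pxy (a b : {ffun C -> bool}) : (exists c, a c && ~~ b c) -> p a b = 0.
  move=> [c /andP[ac bc]]; rewrite /p (_ : _ @^-1` _ = set0) ?measure0//.
  apply/seteqP; split => // o [] xa yb; move: bc ac.
  by rewrite -xa -yb => /negP + /xy.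
have py a b : p a b <= bernoulli_weight rho b.
  rewrite -lee_fin -pE -y_law; apply: le_measure.
  - by rewrite inE.
  - by rewrite inE; exact: measurable_ffun_fiber.
  - by move=> o [].
move=> /(_ p0 p1 pxy py); apply: le_trans; rewrite le_eqVlt; apply/orP; left; apply/eqP.
transitivity (\sum_a \sum_b \sum_c
   (ln t * (p a b *+ [&& ~~ a c, b c & w a c]) - t * rho * (p a b *+ w a c))); last first.
  apply: eq_bigr => a _; apply: eq_bigr => b _; rewrite mulr_sumr.
  apply: eq_bigr => c _; rewrite mulrBr -!mulrnAr [X in _ = X - _]mulrC.
  by rewrite [X in _ = _ - X]mulrC !mulrnAr !mulrnAl.
under [RHS]eq_bigr do rewrite exchange_big.
rewrite exchange_big; apply: eq_bigr => c _.
under [RHS]eq_bigr do rewrite sumrB -!mulr_sumr.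
rewrite sumrB -!mulr_sumr.
by rewrite (p_sum (fun ab => [&& ~~ ab.1 c, ab.2 c & w ab.1 c]))
  (p_sum (fun ab => w ab.1 c)).
Qed.

End domination.

(** * Approximation by an algebra of events *)

Section approximation.
Context (dd : measure_display) (T : measurableType dd) (R : realType).
Variables (P : probability T R) (G : set (set T)).
Hypotheses (GC : setC_closed G) (GI : setI_closed G) (G0 : G set0).
Hypothesis (Ggen : (measurable : set (set T)) = <<s G >>).

Definition symdiff (A B : set T) := (A `\` B) `|` (B `\` A).

Let approximable (E : set T) := measurable E /\ forall e : R, 0 < e ->
  exists2 A, G A & (P (symdiff E A) <= e%:E)%E.

Let GM A : G A -> measurable A.
Proof. by move=> GA; rewrite Ggen; exact: sub_sigma_algebra. Qed.

Let mD A B : measurable A -> measurable B -> measurable (symdiff A B).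
Proof. by move=> mA mB; apply: measurableU; exact: measurableD. Qed.

Let measure_le_cover A B C : measurable A -> measurable B -> measurable C ->
  A `<=` B `|` C -> (P A <= P B + P C)%E.
Proof.
move=> mA mB mC ABC; apply: (@le_trans _ _ (P (B `|` C))).
  by apply: le_measure => //; rewrite inE//; exact: measurableU.
exact: measureU2.
Qed.

Let approximableU A B : approximable A -> approximable B -> approximable (A `|` B).
Proof.
move=> [mA hA] [mB hB]; split; first exact: measurableU.
move=> e e0; have e20 : 0 < e / 2 by rewrite divr_gt0.
have [A' GA' PA] := hA _ e20; have [B' GB' PB] := hB _ e20.
have mA' := GM GA'; have mB' := GM GB'.
exists (A' `|` B').
  by rewrite -[X in G X]setCK setCU; apply/GC/GI; exact/GC.
rewrite [e]splitr EFinD; apply: (le_trans _ (leeD PA PB)).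
apply: measure_le_cover; [exact/mD/measurableU/mB'/mA'/measurableU|exact: mD|exact: mD|].
move=> x; rewrite /symdiff /=.
by have [] := (pselect (A x), pselect (B x)); tauto.
Qed.

(** The sets approximable by members of [G] form a sigma-algebra containing [G]. *)
Lemma measurable_approx (E : set T) (e : R) : measurable E -> 0 < e ->
  exists2 A, G A & (P (symdiff E A) <= e%:E)%E.
Proof.
move=> mE; suff : approximable E by move=> [_]; exact.
move: E mE; rewrite Ggen; apply: smallest_sub; last first.
  move=> A GA; split; first exact: GM.
  move=> e0 e00; exists A => //; rewrite /symdiff setDv setUid measure0 lee_fin.
  exact: ltW.
have D0 : approximable set0.
  split=> // e0 e00; exists set0 => //.
  by rewrite /symdiff setDv setUid measure0 lee_fin ltW.
split => //.
  move=> A [mA hA]; rewrite setTD; split; first exact: measurableC.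
  move=> e0 e00; have [A' GA' PA] := hA _ e00.
  exists (~` A'); first exact: GC.
  rewrite (_ : symdiff _ _ = symdiff A A')//.
  by rewrite /symdiff !setDE !setCK setUC (setIC A') (setIC _ A).
move=> F hF; have mF i : measurable (F i) by case: (hF i).
pose U n := \big[setU/set0]_(i < n) F i.
have hU n : approximable (U n).
  by apply: (big_ind approximable) => // i _.
have mU n : measurable (U n) by case: (hU n).
have mUF : measurable (\bigcup_i F i) by exact: bigcupT_measurable.
split=> // e0 e00; have e20 : 0 < e0 / 2 by rewrite divr_gt0.
(* A countable union is truncated to a finite one: the remainders decrease to the empty set, so
   their probabilities tend to 0. Half of the error is spent here, half on approximating the finite
   union. *)
have [n Pn] : exists n, (P (\bigcup_i F i `\` U n) <= (e0 / 2)%:E)%E.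
  have H : P (\bigcup_i F i `\` U n) @[n --> \oo] --> P (\bigcap_n (\bigcup_i F i `\` U n)).
    apply: nonincreasing_cvg_mu.
    - by rewrite (le_lt_trans (probability_le1 _ _)) ?ltry//; exact: measurableD.
    - by move=> i; exact: measurableD.
    - by apply: bigcapT_measurable => i; exact: measurableD.
    - move=> a b ab; apply/subsetPset; apply: setDS.
      exact: subset_bigsetU.
  have cap0 : \bigcap_n (\bigcup_i F i `\` U n) = set0.
    apply/seteqP; split => // x Hx.
    have [[i _ Fix] _] := Hx 0%N I.
    have [_] := Hx i.+1 I; apply; rewrite /U big_ord_recr; right; exact: Fix.
  rewrite cap0 measure0 in H.
  move/fine_cvgP : H => [_ /cvgr_lt /(_ _ e20)] [n _ /(_ n (leqnn n))] /= Hn.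
  exists n; rewrite -[X in (X <= _)%E]fineK ?lee_fin ?ltW//.
  by rewrite fin_num_measure//; exact: measurableD.
have [_ /(_ _ e20) [A GA PA]] := hU n.
have mA := GM GA.
exists A => //; rewrite [e0]splitr EFinD; apply: (le_trans _ (leeD Pn PA)).
apply: measure_le_cover; [exact: mD|exact: measurableD|exact: mD|].
move=> x [[Fx nA]|[Ax nF]].
  by have [Ux|nUx] := pselect (U n x); [right; left|left].
right; right; split => //; move: nF; rewrite /U -bigcup_mkord.
by apply: contra_not => -[i _ Fi]; exists i.
Qed.

End approximation.

(** * Dyadic cells *)

Section grid.
Context {R : realType}.

(** Half-open boxes tile the space. Slicing at the first coordinate gives a box of one dimension
    less or the empty set, hence a constant times the indicator of an interval. *)
Lemma vol_rbox (d : nat) (a b : 'rV[R]_d) :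
  (forall i, a ord0 i <= b ord0 i) ->
  vol [set x : 'rV[R]_d | forall i, a ord0 i <= x ord0 i < b ord0 i] =
  (\prod_(i < d) (b ord0 i - a ord0 i))%:E.
Proof.
elim: d a b => [|d IH] a b ab.
  by rewrite big_ord0 /= diracE mem_set//= => -[].
rewrite big_ord_recl /=.
pose a' : 'rV[R]_d := \row_i a ord0 (lift ord0 i).
pose b' : 'rV[R]_d := \row_i b ord0 (lift ord0 i).
pose c := \prod_(i < d) (b ord0 (lift ord0 i) - a ord0 (lift ord0 i)).
have c0 : 0 <= c by apply: prodr_ge0 => i _; rewrite subr_ge0.
have rmx0 (t : R) (v : 'rV[R]_d) :
    row_mx (const_mx t : 'rV[R]_1) v ord0 (ord0 : 'I_(1 + d)) = t.
  have {2}<- : (const_mx t : 'rV[R]_1) ord0 ord0 = t by rewrite mxE.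
  by rewrite -[RHS](row_mxEl _ v); congr (row_mx _ _ _ _); exact/val_inj.
have rmxS (t : R) (v : 'rV[R]_d) (i : 'I_d) :
    row_mx (const_mx t : 'rV[R]_1) v ord0 (lift ord0 i : 'I_(1 + d)) = v ord0 i.
  rewrite -[RHS](row_mxEr (const_mx t : 'rV[R]_1) v).
  by congr (row_mx _ _ _ _); exact/val_inj.
transitivity (\int[lebesgue_measure]_t
    (c%:E * (\1_`[a ord0 ord0, b ord0 ord0[ t)%:E))%E.
  apply: eq_integral => t _; rewrite indicE.
  case: (boolP (t \in _)) => [|tn]; rewrite ?inE/=.
    rewrite in_itv /= => tab; rewrite mule1.
    have -> : c = \prod_(i < d) (b' ord0 i - a' ord0 i).
      by apply: eq_bigr => i _; rewrite !mxE.
    rewrite -IH; last by move=> i; rewrite !mxE.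
    congr vol; apply/seteqP; split => v /= H i.
      by rewrite !mxE; have := H (lift ord0 i); rewrite rmxS.
    case: (unliftP ord0 i) => [j|] ->; last by rewrite rmx0.
    by rewrite rmxS; have := H j; rewrite !mxE.
  rewrite mule0 -(vol_set0 d); congr vol; apply/seteqP; split => v //= H.
  move: tn; rewrite notin_setE/= in_itv/=.
  by have := H ord0; rewrite rmx0.
rewrite ge0_integralZl_EFin//; last first.
  apply/measurable_EFinP; exact: measurable_indic.
rewrite integral_indic// setIT /= lebesgue_measure_itv /= lte_fin.
case: ltP => [_|ba]; first by rewrite -EFinB -EFinM mulrC.
have -> : b ord0 ord0 - a ord0 ord0 = 0.
  by apply/eqP; rewrite subr_eq0 eq_le ab ba.
by rewrite mul0r mule0.
Qed.

Variable d : nat.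
Implicit Types (h : R) (m k : 'rV[int]_d) (x : 'rV[R]_d).

Definition gridpt h x : 'rV[int]_d := \row_i Num.floor (x ord0 i / h).

(** As fibres of [gridpt], the cells are disjoint and cover the space by construction. *)
Definition cell h m : set 'rV[R]_d := [set x | gridpt h x = m].

Lemma cellP h m x : 0 < h -> cell h m x <->
  forall i, (m ord0 i)%:~R * h <= x ord0 i < (m ord0 i + 1)%:~R * h.
Proof.
move=> h0; split => [<- i|H].
  by rewrite mxE -ler_pdivlMr// -ltr_pdivrMr// floor_itv.
apply/rowP => i; rewrite mxE; apply/floor_def.
by rewrite ler_pdivlMr// ltr_pdivrMr.
Qed.

Lemma vol_cell h m : 0 < h -> vol (cell h m) = (h ^+ d)%:E.
Proof.
move=> h0.
pose a : 'rV[R]_d := \row_i ((m ord0 i)%:~R * h).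
pose b : 'rV[R]_d := \row_i ((m ord0 i + 1)%:~R * h).
rewrite [X in vol X](_ : _ =
    [set x : 'rV[R]_d | forall i, a ord0 i <= x ord0 i < b ord0 i]); last first.
  by apply/seteqP; split => x; rewrite /= ?cellP// => H i; have := H i; rewrite !mxE.
rewrite vol_rbox => [|i]; last first.
  by rewrite !mxE ler_pM2r// ler_int lerDl.
congr EFin; rewrite (eq_bigr (fun=> h)) ?prodr_const ?card_ord// => i _.
by rewrite !mxE -mulrBl -intrB addrAC subrr add0r mul1r.
Qed.

Lemma measurable_coord (i : 'I_d) :
  measurable_fun [set: 'rV[R]_d] (fun x : 'rV[R]_d => x ord0 i).
Proof.
apply: (measurability _ (RGenOpens.measurableE R)) => //.
move=> _ [_ [a [b ->]] <-]; rewrite setTI; apply: sub_sigma_algebra.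
have /continuousP := @coord_continuous R 1 d ord0 i; apply.
exact: interval_open.
Qed.

Lemma measurable_cell h m : 0 < h -> measurable (cell h m).
Proof.
move=> h0.
rewrite (_ : cell h m = \bigcap_(i in [set: 'I_d])
    ((fun x : 'rV[R]_d => x ord0 i) @^-1`
      `[(m ord0 i)%:~R * h, (m ord0 i + 1)%:~R * h[%classic)).
  apply: fin_bigcap_measurable => // i _; rewrite -[X in measurable X]setTI.
  exact: measurable_coord.
apply/seteqP; split => x.
  by move=> /cellP H i _ /=; rewrite in_itv /=; exact: H.
by move=> H; apply/cellP => // i; have := H i I; rewrite /= in_itv.
Qed.

Definition shift h k : 'rV[R]_d := \row_i ((k ord0 i)%:~R * h).

Lemma gridpt_shift h k x : 0 < h -> gridpt h (x + shift h k) = gridpt h x + k.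
Proof.
move=> h0; apply/rowP => i; rewrite !mxE mulrDl mulfK ?gt_eqF//.
by rewrite floorDrz ?intrEfloor ?intr_int// intrKfloor.
Qed.

(** Index, in the grid of mesh [h / K], of the child of cell [m] at position [j]. *)
Definition subcell (K : nat) m (j : {ffun 'I_d -> 'I_K}) : 'rV[int]_d :=
  \row_i (m ord0 i * K%:Z + (j i : nat)%:Z).

Lemma cell_refine h (K : nat) m : 0 < h -> (0 < K)%N ->
  cell h m = \bigcup_(j in [set: {ffun 'I_d -> 'I_K}]) cell (h / K%:R) (subcell m j).
Proof.
move=> h0 K0.
have K0r : 0 < K%:R :> R by rewrite ltr0n.
have xhK x i : x ord0 i / (h / K%:R) = x ord0 i / h * K%:R.
  by rewrite invf_div mulrCA mulrC.
apply/seteqP; split => [x mx|x [j _ jx]].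
  (* The position inside the parent cell: floor (K y) - K floor y lies between 0 and K - 1. *)
  pose e i := Num.floor (x ord0 i / (h / K%:R)) - m ord0 i * K%:Z.
  have e0 i : 0 <= e i < K%:Z.
    rewrite /e -mx mxE xhK; set y := x ord0 i / h.
    have /andP[y1 y2] := floor_itv y.
    have /andP[z1 z2] := floor_itv (y * K%:R).
    rewrite subr_ge0 floor_ge_int intrM ler_wpM2r//=.
    rewrite ltrBlDr -(ltr_int R) (le_lt_trans z1)//.
    move: y2; rewrite -(ltr_pM2r K0r) !intrD intrM -[K%:Z%:~R]pmulrn => y2.
    by rewrite (lt_le_trans y2)// mulrDl mul1r addrC.
  have fK i : (`|e i| < K)%N.
    by have /andP[H1 H2] := e0 i; rewrite -ltz_nat gez0_abs.
  exists [ffun i => Ordinal (fK i)] => //; apply/rowP => i.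
  have /andP[H1 H2] := e0 i.
  by rewrite !mxE ffunE/= gez0_abs// /e addrC subrK.
apply/rowP => i; rewrite mxE; apply/floor_def.
have /(congr1 (fun m : 'rV[int]_d => m ord0 i)) := jx.
rewrite !mxE xhK; set y := x ord0 i / h => jy.
have := floor_itv (y * K%:R); rewrite jy.
have jK : ((j i : nat)%:Z + 1 <= K%:Z) by have := ltn_ord (j i); lia.
have j0 : (m ord0 i * K%:Z)%:~R <= (m ord0 i * K%:Z + (j i : nat)%:Z)%:~R :> R.
  by rewrite ler_int lerDl.
have j1 : (m ord0 i * K%:Z + (j i : nat)%:Z + 1)%:~R <= ((m ord0 i + 1) * K%:Z)%:~R :> R.
  by rewrite ler_int mulrDl mul1r -addrA lerD2l.
move=> /andP[H1 H2]; apply/andP; split.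
  by rewrite -(ler_pM2r K0r) (le_trans _ H1)// [K%:R]pmulrn -intrM.
by rewrite -(ltr_pM2r K0r) (lt_le_trans H2)// [K%:R]pmulrn -intrM.
Qed.
End grid.

Section dyadic.
Context {R : realType} (d : nat) (delta : R).
Hypothesis delta_gt0 : 0 < delta.
Implicit Types (m k : 'rV[int]_d) (x y : 'rV[R]_d).

Definition side n : R := delta / (2 ^ n)%:R.

Lemma side_gt0 n : 0 < side n.
Proof. by rewrite divr_gt0// ltr0n expn_gt0. Qed.

Lemma sideD n p : side (n + p) = side n / (2 ^ p)%:R.
Proof. by rewrite /side expnD natrM invfM mulrA. Qed.

Lemma side_small (e : R) : 0 < e -> exists n0, forall n, (n0 <= n)%N -> side n < e.
Proof.
move=> e0; have [n0 hn0] : exists n0 : nat, delta / e < n0%:R.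
  by eexists; apply: archi_boundP; rewrite divr_ge0// ltW.
exists n0 => n n0n; rewrite /side ltr_pdivrMr ?ltr0n ?expn_gt0// mulrC.
rewrite -ltr_pdivrMr// (lt_le_trans hn0)// ler_nat (leq_trans n0n)//.
by rewrite ltnW// ltn_expl.
Qed.

Definition dcell n m : set 'rV[R]_d := cell (side n) m.

Lemma measurable_dcell n m : measurable (dcell n m).
Proof. by apply: measurable_cell; exact: side_gt0. Qed.

Lemma dcell_refine n p m :
  dcell n m = \bigcup_(j in [set: {ffun 'I_d -> 'I_(2 ^ p)}]) dcell (n + p) (subcell m j).
Proof.
by rewrite /dcell sideD; apply: cell_refine; rewrite ?side_gt0 ?expn_gt0.
Qed.

Lemma dcell_sub n p m k x :
  dcell n m x -> dcell (n + p) k x -> dcell (n + p) k `<=` dcell n m.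
Proof.
rewrite (dcell_refine n p) => -[j _ jx] kx y ky; exists j => //.
by rewrite (_ : subcell m j = k)// -jx -kx.
Qed.

Lemma dcell_ball n m x y : dcell n m x -> dcell n m y -> ball x (side n) y.
Proof.
move=> /(cellP _ _ (side_gt0 n)) Hx /(cellP _ _ (side_gt0 n)) Hy.
split=> [|i j]; first exact: side_gt0.
rewrite (ord1 i); have /andP[x1 x2] := Hx j; have /andP[y1 y2] := Hy j.
rewrite -ball_normE /= ltr_norml.
move: x2 y2; rewrite !intrD !mulrDl !mul1r => x2 y2.
by apply/andP; split; lra.
Qed.

(** The empty set is included to obtain a pi-system. *)
Definition dcells : set (set 'rV[R]_d) :=
  [set A | A = set0 \/ exists n m, A = dcell n m].

(** Two dyadic cells are nested or disjoint; by symmetry the first may be taken to be the coarser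
    one. *)
Lemma dcells_setI_closed : setI_closed dcells.
Proof.
suff H n p m k : dcells (dcell n m `&` dcell (n + p) k).
  move=> A B [->|[n [m ->]]]; first by rewrite set0I; left.
  move=> [->|[n' [m' ->]]]; first by rewrite setI0; left.
  have [nn'|/ltnW nn'] := leqP n n'; first by rewrite -(subnKC nn').
  by rewrite setIC -(subnKC nn').
have [[x [xm xk]]|] := pselect (exists x, dcell n m x /\ dcell (n + p) k x).
  by right; exists (n + p)%N, k; apply/setIidPr; exact: dcell_sub xm xk.
move=> H; left; apply/seteqP; split => // x [xm xk].
by apply: H; exists x.
Qed.

(** An open set is the union of the dyadic cells that it contains, and there are only countably many
    cells. *)
Lemma dcells_generate : (measurable : set (set 'rV[R]_d)) = <<s dcells >>.
Proof.
apply/seteqP; split.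
  apply: smallest_sub; first exact: smallest_sigma_algebra.
  move=> U oU.
  pose V := \bigcup_(q in [set q : nat * 'rV[int]_d | dcell q.1 q.2 `<=` U])
     dcell q.1 q.2.
  have -> : U = V.
    apply/seteqP; split => [x Ux|x [q qU qx]]; last exact: qU.
    move: (oU); rewrite openE => /(_ x Ux) /nbhs_ballP[e /= e0 eU].
    have [n ne] := side_small e0.
    exists (n, gridpt (side n) x) => //= y yx.
    apply: eU; apply: le_ball (ltW (ne n (leqnn n))) _ _.
    by apply: dcell_ball yx.
  have msG (F : nat * 'rV[int]_d -> set 'rV[R]_d) :
    (forall q, <<s dcells >> (F q)) -> <<s dcells >> (\bigcup_q F q).
    exact: (@countable_bigcupT_measurable _ (g_sigma_algebraType dcells)).
  rewrite /V bigcup_mkcond; apply: msG => q; case: ifP => _.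
    by apply: sub_sigma_algebra; right; exists q.1, q.2.
  exact: (@measurable0 _ (g_sigma_algebraType dcells)).
apply: smallest_sub; first exact: sigma_algebra_measurable.
move=> _ [->|[n [m ->]]]; [exact: measurable0|exact: measurable_dcell].
Qed.

Lemma bounded_dcell n m : bounded_set (dcell n m).
Proof.
have [x mx] : dcell n m !=set0.
  exists (shift (side n) m).
  by rewrite /dcell /cell/= -(add0r (shift _ _)) gridpt_shift ?side_gt0//;
     apply/rowP => i; rewrite !mxE mul0r floor0 add0r.
exists (`|x| + side n); split; first exact: num_real.
move=> M hM y my /=; rewrite (le_trans _ (ltW hM))//.
rewrite -[y](subrK x) addrC (le_trans (ler_normD _ _))// lerD2l//.
have := dcell_ball my mx; rewrite -ball_normE => /ltW.
by [].
Qed.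

End dyadic.

(** * Occupation patterns of point measures *)

Section point_counts.
Context {R : realType} (d : nat) (delta : R).
Hypothesis delta_gt0 : 0 < delta.
Local Notation M := (point_measure R d).
Implicit Types (mu nu : M) (m k : 'rV[int]_d) (x y : 'rV[R]_d).

Lemma point_measure_card mu : exists2 S : set 'rV[R]_d, locally_finite S &
  forall A, mu A = (\esum_(x in S `&` A) 1)%E.
Proof.
have [S fS muE] := point_measureP mu; exists S => // A.
rewrite muE esum_mkcondr; apply: eq_esum => x Sx.
by rewrite diracE; case: ifP.
Qed.

Lemma point_measure_fin_num mu (A : set 'rV[R]_d) :
  bounded_set A -> mu A \is a fin_num.
Proof.
have [S fS ->] := point_measure_card mu => /fS fA.
by rewrite (@finite_card_sum _ 'rV[R]_d).
Qed.

(** A mesh below the finitely many positive distances in the list suffices. *)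
Lemma separate_points (s : seq ('rV[R]_d * 'rV[R]_d)) : exists n0, forall n,
  (n0 <= n)%N -> forall p, p \in s -> ball p.1 (side delta n) p.2 -> p.1 = p.2.
Proof.
elim: s => [|[x y] s [n0 IH]]; first by exists 0%N.
have [xy|/eqP xy] := eqVneq x y.
  exists n0 => n n0n p; rewrite in_cons => /predU1P[->//|]; exact: IH.
have xy0 : 0 < `|x - y| by rewrite normr_gt0 subr_eq0; apply/eqP.
have [n1 H1] := side_small delta_gt0 xy0.
exists (maxn n0 n1) => n; rewrite geq_max => /andP[n0n n1n] p.
rewrite in_cons => /predU1P[->/=|]; last exact: IH.
by rewrite -ball_normE /= => /lt_trans /(_ (H1 n n1n)); rewrite ltxx.
Qed.

Definition occ mu n m : bool := mu (dcell delta n m) != 0%E.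

(** Only finitely many points of [mu] lie in [Q]. Once the mesh separates them, a cell inside [Q]
    holds at most one, and that point has mass 1. *)
Lemma eventually_occ mu (Q : set 'rV[R]_d) : bounded_set Q ->
  exists n0, forall n, (n0 <= n)%N -> forall m, dcell delta n m `<=` Q ->
    mu (dcell delta n m) = (occ mu n m)%:R%:E.
Proof.
have [S fS muE] := point_measure_card mu => /fS /finite_seqP[s sE].
have [n0 H] := separate_points [seq (x, y) | x <- s, y <- s].
exists n0 => n n0n m mQ; rewrite /occ muE.
have [->|[x [Sx mx]]] : S `&` dcell delta n m = set0 \/
  exists x, (S `&` dcell delta n m) x.
- have [->|/set0P[x]] := eqVneq (S `&` dcell delta n m) set0; [by left|].
  by right; exists x.
- by rewrite esum_set0 eqxx.
have -> : S `&` dcell delta n m = [set x].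
  apply/seteqP; split => [y [Sy my]|y ->//].
  apply/esym; apply: (H n n0n (x, y)); last exact: dcell_ball mx my.
  have xs z : S z -> dcell delta n m z -> z \in s.
    move=> Sz mz; have : (S `&` Q) z by split => //; exact: mQ.
    by rewrite sE.
  by apply/allpairsP; exists (x, y); split => //=; exact: xs.
by rewrite esum_set1// eqe oner_eq0.
Qed.

Lemma subcell_inj (K : nat) m : injective (@subcell d K m).
Proof.
move=> i j /rowP ij; apply/ffunP => a; apply/val_inj.
by have := ij a; rewrite !mxE => /addrI [].
Qed.

Lemma dcell_count mu n m p :
  mu (dcell delta n m) = (\sum_(j : {ffun 'I_d -> 'I_(2 ^ p)})
    mu (dcell delta (n + p) (subcell m j)))%E.
Proof.
rewrite (dcell_refine delta_gt0 n p) measure_bigcup_finType//.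
  by move=> j; exact: measurable_dcell.
by move=> i j _ _ [x [ix jx]]; apply: (@subcell_inj _ m); rewrite -ix -jx.
Qed.

Lemma occ_refine mu n m p :
  occ mu n m = [exists j : {ffun 'I_d -> 'I_(2 ^ p)}, occ mu (n + p) (subcell m j)].
Proof.
rewrite /occ; apply/idP/existsP => [|[j]].
  apply: contraNP => /forallNP H; rewrite (dcell_count mu n m p) big1// => j _.
  by apply/eqP/negPn/negP; exact: H.
apply: contra_neq => m0; apply/eqP; rewrite -measure_le0 -m0.
rewrite le_measure ?inE//; [exact: measurable_dcell|exact: measurable_dcell|].
by rewrite (dcell_refine delta_gt0 n p) => x; exists j.
Qed.

Definition in_window K m := forall i, - K%:Z <= m ord0 i < K%:Z.

(* The half-width N of the window is counted in blocks of side delta, not in cells. *)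
Definition local_at n N (A : set M) := forall mu nu,
  (forall m, in_window (N * 2 ^ n) m -> occ mu n m = occ nu n m) -> A mu -> A nu.

(** A coarse cell is occupied exactly when one of its children is, so a finer pattern on a larger
    window determines the coarser one. *)
Lemma local_atW n N n' N' A : (n <= n')%N -> (N <= N')%N ->
  local_at n N A -> local_at n' N' A.
Proof.
move=> nn' NN' lA mu nu H; apply: lA => m mW.
rewrite !(occ_refine _ n m (n' - n)) subnKC//.
apply: eq_existsb => j; apply: H => i; rewrite mxE.
have /andP[m1 m2] := mW i.
have j1 := ltn_ord (j i).
have -> : (N' * 2 ^ n' = (N' * 2 ^ n) * 2 ^ (n' - n))%N.
  by rewrite -mulnA -expnD subnKC.
have : (N * 2 ^ n <= N' * 2 ^ n)%N by rewrite leq_mul2r NN' orbT.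
move: (N * 2 ^ n)%N (N' * 2 ^ n)%N (2 ^ (n' - n))%N (j i : nat) (m ord0 i) j1 m1 m2.
by move=> a b K j' mi j1 m1 m2 ab; nia.
Qed.

(** Cylinder events, the algebra to which [measurable_approx] will be applied. *)
Definition local_event : set (set M) :=
  [set A | measurable A /\ exists n N, local_at n N A].

Lemma local_eventC : setC_closed local_event.
Proof.
move=> A [mA [n [N lA]]]; split; first exact: measurableC.
by exists n, N => mu nu H nA Anu; apply: nA; apply: lA Anu => m /H.
Qed.

Lemma local_eventI : setI_closed local_event.
Proof.
move=> A B [mA [n [N lA]]] [mB [n' [N' lB]]]; split; first exact: measurableI.
exists (maxn n n'), (maxn N N') => mu nu H [Amu Bmu]; split.
  by apply: (local_atW _ _ lA) H Amu; rewrite leq_maxl.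
by apply: (local_atW _ _ lB) H Bmu; rewrite leq_maxr.
Qed.

Lemma measurable_occ n m : measurable [set mu : M | occ mu n m].
Proof.
rewrite (_ : [set _ | _] = setT `&` (fun mu : M => mu (dcell delta n m)) @^-1` ~` [set 0%E]).
  apply: measurable_evaluation => //; first exact: measurable_dcell.
  exact: measurableC.
by rewrite setTI; apply/seteqP; split => mu /eqP.
Qed.

Lemma local_event_occ n m : local_event [set mu : M | occ mu n m].
Proof.
split; first exact: measurable_occ.
(* Each coordinate satisfies |m_i| < N <= N 2^n, so the window contains the cell [m]. *)
pose N := (\sum_i `|m ord0 i|).+1%N.
exists n, N => mu nu H /=; rewrite (H m)// => i.
have key (a b : nat) (c : int) : (`|c| < a)%N -> (0 < b)%N ->
  - (a * b)%N%:Z <= c < (a * b)%N%:Z by nia.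
by apply: key; rewrite ?expn_gt0// ltnS (bigD1 i)//= leq_addr.
Qed.

Local Notation G := (g_sigma_algebraType local_event).

(* A point measure is simple, so the number of occupied subcells of a cell
   is eventually equal to the number of its points. *)
Lemma measurable_local_count n m :
  measurable_fun setT (fun mu : G => (mu : M) (dcell delta n m)).
Proof.
pose f p (mu : G) := (\sum_(j : {ffun 'I_d -> 'I_(2 ^ p)})
   (\1_[set mu : G | occ mu (n + p) (subcell m j)] mu)%:E)%E : \bar R.
apply: (@emeasurable_fun_cvg _ G _ _ f) => [p|mu _].
  apply: emeasurable_sum => j; apply/measurable_EFinP.
  apply: measurable_indic; apply: sub_sigma_algebra; exact: local_event_occ.
have [n0 H] := eventually_occ mu (bounded_dcell delta_gt0 n m).
apply: cvg_near_cst; exists n0 => //= p n0p.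
rewrite (dcell_count mu n m p) /f; apply: eq_bigr => j _.
rewrite H ?(leq_trans n0p) ?leq_addl//.
  by rewrite indicE; case: (boolP (occ _ _ _)) => o;
    [rewrite mem_set|rewrite memNset//; apply/negP].
by rewrite (dcell_refine delta_gt0 n p) => x; exists j.
Qed.

(** It suffices to treat the trace of [B] on each of the countably many cells of level 0. There a
    Dynkin induction starts from the dyadic cells; its complement step subtracts counts, which are
    finite because the cell is bounded. *)
Lemma measurable_local_eval (B : set 'rV[R]_d) : measurable B ->
  measurable_fun setT (fun mu : G => (mu : M) B).
Proof.
move=> mB.
suff H m : measurable_fun setT (fun mu : G => (mu : M) (B `&` dcell delta 0 m)).
  (* The test on [pickle m] makes each cell appear at one index only, since [unpickle] may return
     the same cell at several indices. *)
  pose D i := if (unpickle i : option 'rV[int]_d) is Some m then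
    (if pickle m == i then B `&` dcell delta 0 m else set0) else set0.
  have DE : B = \bigcup_i D i.
    apply/seteqP; split => [x Bx|x [i _]].
      exists (pickle (gridpt (side delta 0) x)) => //.
      by rewrite /D pickleK eqxx.
    by rewrite /D; case: unpickle => // m; case: ifP => // _ [].
  have mD i : measurable (D i).
    rewrite /D; case: unpickle => // m; case: ifP => // _.
    by apply: measurableI => //; exact: measurable_dcell.
  have tD : trivIset setT D.
    move=> i j _ _ [x []]; rewrite /D.
    case: unpickle => // a; case: eqP => // <- [_ <-].
    by case: unpickle => // b; case: eqP => // <- [_ <-].
  have E (mu : G) : (mu : M) B = (\sum_(0 <= i <oo) (mu : M) (D i))%E.
    by rewrite {1}DE measure_bigcup//; apply: eq_eseriesl => i; rewrite in_setT.
  under eq_fun do rewrite E.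
  apply: ge0_emeasurable_sum => // i _.
  rewrite /D; case: unpickle => [a|]; first case: ifP => // _.
  - under eq_fun do rewrite measure0; exact: measurable_cst.
  - under eq_fun do rewrite measure0; exact: measurable_cst.
pose Pr (B : set 'rV[R]_d) :=
  measurable_fun setT (fun mu : G => (mu : M) (B `&` dcell delta 0 m)).
rewrite -/(Pr B).
have gen := dcells_generate d delta_gt0.
apply: (dynkin_induction gen (dcells_setI_closed delta_gt0)); last by rewrite -gen.
- rewrite /Pr; under eq_fun do rewrite setTI; exact: measurable_local_count.
- move=> A dA; have : dcells delta (A `&` dcell delta 0 m).
    by apply: dcells_setI_closed => //; right; exists 0%N, m.
  rewrite /Pr => -[|[n [k]]] ->; last exact: measurable_local_count.
  under eq_fun do rewrite measure0; exact: measurable_cst.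
- move=> S mS PS; rewrite /Pr.
  have E (mu : G) : (mu : M) (~` S `&` dcell delta 0 m) =
     ((mu : M) (dcell delta 0 m) - (mu : M) (S `&` dcell delta 0 m))%E.
    have mQ := measurable_dcell delta_gt0 0 m.
    have Qoo : ((mu : M) (dcell delta 0 m) < +oo)%E.
      by rewrite ltey_eq point_measure_fin_num//; exact: bounded_dcell.
    by rewrite setIC -setDE (measureD mQ mS Qoo) setIC.
  under eq_fun do rewrite E.
  apply: emeasurable_funB => //; exact: measurable_local_count.
- move=> F mF tF PF; rewrite /Pr.
  have E (mu : G) : (mu : M) ((\bigcup_i F i) `&` dcell delta 0 m) =
      (\sum_(0 <= i <oo) (mu : M) (F i `&` dcell delta 0 m))%E.
    rewrite setI_bigcupl measure_bigcup//.
    + by apply: eq_eseriesl => i; rewrite in_setT.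
    + by move=> i _; apply: measurableI => //; exact: measurable_dcell.
    + by apply: trivIset_setIr.
  under eq_fun do rewrite E.
  by apply: ge0_emeasurable_sum => // i _; exact: PF.
Qed.

Lemma local_event_generate : (measurable : set (set M)) = <<s local_event >>.
Proof.
apply/seteqP; split; apply: smallest_sub.
- exact: smallest_sigma_algebra.
- move=> _ [B /= mB [C mC <-]]; exact: measurable_local_eval.
- exact: sigma_algebra_measurable.
- by move=> A [].
Qed.

End point_counts.

(** * Occupation patterns of a Poisson process and stationarity *)

Section poisson_law.
Context {R : realType} (d : nat) (delta : R).
Hypothesis delta_gt0 : 0 < delta.
Local Notation M := (point_measure R d).
Context (dd : measure_display) (Omega : measurableType dd)
  (Pr : probability Omega R).
Implicit Types (mu nu : M) (m k z : 'rV[int]_d) (x y : 'rV[R]_d).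

Lemma measurable_translate (t : 'rV[R]_d) :
  measurable_fun setT (translate t : M -> M).
Proof.
apply: (@measurability _ _ _ _ _ _ (evaluation_sets (R := R) (d := d))) => //.
move=> _ [_ [B /= mB [C mC <-]] <-].
rewrite setTI setTI -comp_preimage.
have mB' : measurable ((fun x : 'rV[R]_d => x + t) @^-1` B).
  by rewrite -[X in measurable X]setTI; exact: measurable_translation.
by have := measurable_evaluation mB' measurableT mC; rewrite setTI.
Qed.

(** A translation by [z] blocks moves the indices of level [n] by 2^n z, since a block is 2^n cells
    wide. *)
Lemma occ_translate mu n m z : occ delta (translate (shift delta z) mu) n m =
  occ delta mu n (m - z *+ 2 ^ n).
Proof.
rewrite /occ translateE /pushforward; congr (mu _ != 0%E).
have -> : shift delta z = shift (side delta n) (z *+ 2 ^ n) :> 'rV[R]_d.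
  apply/rowP => i; rewrite !mxE mulmxnE rmorphMn /= -mulr_natr /side -mulrA.
  by rewrite [X in _ = _ * X]mulrCA divff ?mulr1// pnatr_eq0 expn_eq0.
apply/seteqP; split => x; rewrite /dcell /cell /= gridpt_shift ?side_gt0//.
  by move=> <-; rewrite addrK.
by move=> ->; rewrite subrK.
Qed.

(** Probability that a Poisson process of intensity [lam] occupies a given cell of level [n]. *)
Definition rho (lam : R) n := 1 - expR (- (lam * side delta n ^+ d)).

Lemma rho01 lam n : 0 < lam -> 0 <= rho lam n <= 1.
Proof.
move=> lam0; rewrite /rho subr_ge0 gerBl expR_ge0 andbT -expR0 ler_expR.
by rewrite oppr_le0 mulr_ge0// ?exprn_ge0// ltW// side_gt0.
Qed.

Variables (lam : R) (X : Omega -> M).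
Hypotheses (lam_gt0 : 0 < lam) (mX : measurable_fun setT X).
Hypothesis X_poisson : homogeneous_poisson Pr lam X.

Lemma measurable_preimage_occ n m : measurable [set w | occ delta (X w) n m].
Proof.
have := mX measurableT (measurable_occ delta_gt0 n m).
by rewrite setTI.
Qed.

Lemma void_probability n m :
  Pr [set w | X w (dcell delta n m) = 0%E] = (1 - rho lam n)%:E.
Proof.
have [H _ _] := X_poisson.
have volE : vol (dcell delta n m) = (side delta n ^+ d)%:E.
  by apply: vol_cell; exact: side_gt0.
have := H _ (measurable_dcell delta_gt0 n m); rewrite volE ltry => /(_ isT 0%N) ->.
rewrite /poisson_prob /= mulr_gt0 ?exprn_gt0 ?side_gt0//.
rewrite esum_set1 /poisson_pmf mulr_gt0 ?exprn_gt0 ?side_gt0//.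
  by rewrite expr0 fact0 invr1 !mul1r /rho subKr.
by rewrite lee_fin expr0 fact0 invr1 !mul1r expR_ge0.
Qed.

(** Distinct cells are disjoint, so their counts are independent; [Z] prescribes for each cell a
    zero or a nonzero count. *)
Lemma occ_law n (C : finType) (c : C -> 'rV[int]_d) (b : {ffun C -> bool}) :
  injective c ->
  Pr [set w | [ffun i => occ delta (X w) n (c i)] = b] =
  (bernoulli_weight (rho lam n) b)%:E.
Proof.
move=> cinj; have [_ _ H] := X_poisson.
pose B (i : 'I_#|C|) := dcell delta n (c (enum_val i)).
pose Z (i : 'I_#|C|) : set (\bar R) :=
  if b (enum_val i) then ~` [set 0%E] else [set 0%E].
have mZ i : measurable (Z i).
  by rewrite /Z; case: ifP => // _; exact: measurableC.
have tB : trivIset setT B.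
  move=> i j _ _ [x [ix jx]]; apply/enum_val_inj/cinj.
  by rewrite -ix -jx.
have := H _ B (fun i => measurable_dcell delta_gt0 n _) tB Z mZ.
rewrite (_ : \bigcap_i _ = [set w | [ffun i => occ delta (X w) n (c i)] = b]); last first.
  apply/seteqP; split => w /=.
    move=> Hw; apply/ffunP => i; rewrite ffunE.
    have := Hw (enum_rank i) I; rewrite /Z /B /= enum_rankK /occ.
    by case: (b i) => /eqP // ->.
  move=> bE i _; rewrite /Z /B /= -bE ffunE /occ.
  by case: ifPn => [/eqP|/negPn/eqP].
move=> ->; rewrite /bernoulli_weight -prodEFin [RHS](reindex _ (onW_bij _ (@enum_val_bij C))).
apply: eq_bigr => i _; rewrite /Z /B; case: (b _); last exact: void_probability.
rewrite [X in Pr X](_ : _ = ~` [set w | X w (dcell delta n (c (enum_val i))) = 0%E])//.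
rewrite probability_setC ?void_probability.
  by rewrite -EFinB opprB addrC subrK.
rewrite (_ : [set w | _] = ~` [set w | occ delta (X w) n (c (enum_val i))]).
  by apply: measurableC; exact: measurable_preimage_occ.
by apply/seteqP; split => w /=; [move=> /eqP|move=> /negP/negPn/eqP]; rewrite /occ // => ->.
Qed.

(** Enumerates the cells of a cube of K^d cells with lowest corner [s]. *)
Definition offset_cell (K : nat) (s : 'rV[int]_d) (j : {ffun 'I_d -> 'I_K}) : 'rV[int]_d :=
  \row_i (s ord0 i + (j i : nat)%:Z).

Lemma offset_cell_inj K s : injective (@offset_cell K s).
Proof.
move=> i j /rowP ij; apply/ffunP => a; apply/val_inj.
by have := ij a; rewrite !mxE => /addrI [].
Qed.

(** The translated event says that the pattern in a displaced window belongs to the set of patterns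
    realised by [A]. The displacement affects only the corner [s], not that set. *)
Lemma local_event_preimage n N (A : set M) (z : 'rV[int]_d) :
  local_at delta n N A ->
  let K := (N * 2 ^ n)%N in
  let s := - const_mx K%:Z - z *+ 2 ^ n in
  X @^-1` (translate (shift delta z) @^-1` A) =
  [set w | `[< exists2 mu, A mu &
    [ffun j : {ffun 'I_d -> 'I_(K + K)} => occ delta mu n (offset_cell (- const_mx K%:Z) j)] =
    [ffun j => occ delta (X w) n (offset_cell s j)] >] ].
Proof.
move=> lA K s.
have E mu (j : {ffun 'I_d -> 'I_(K + K)}) :
    occ delta (translate (shift delta z) mu) n (offset_cell (- const_mx K%:Z) j) =
    occ delta mu n (offset_cell s j).
  by rewrite occ_translate; congr (occ _ _ _ _); apply/rowP => i; rewrite !mxE addrAC.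
apply/seteqP; split => w /=.
  move=> Aw; apply/asboolP; exists (translate (shift delta z) (X w)) => //.
  by apply/ffunP => j; rewrite !ffunE E.
move=> /asboolP[mu Amu H]; apply: lA Amu => m mW.
have keyK (a : nat) (c : int) : - a%:Z <= c < a%:Z -> (`|(c + a%:Z)%R| < a + a)%N.
  by lia.
have keyE (a : nat) (c : int) : - a%:Z <= c < a%:Z -> c = - a%:Z + `|(c + a%:Z)%R|%N%:Z.
  by lia.
have jK i : (`|(m ord0 i + K%:Z)%R| < K + K)%N.
  exact: keyK (mW i).
have -> : m = offset_cell (- const_mx K%:Z) [ffun i => Ordinal (jK i)].
  by apply/rowP => i; rewrite !mxE ffunE /=; exact: keyE (mW i).
by rewrite E; move/ffunP/(_ [ffun i => Ordinal (jK i)]): H; rewrite !ffunE.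
Qed.

(** The point is that the right-hand side does not involve [z]. *)
Lemma local_law n N (A : set M) (z : 'rV[int]_d) : local_at delta n N A ->
  Pr (X @^-1` (translate (shift delta z) @^-1` A)) =
  (\sum_(b | `[< exists2 mu, A mu &
    [ffun j : {ffun 'I_d -> 'I_(N * 2 ^ n + N * 2 ^ n)} => occ delta mu n
      (offset_cell (- const_mx (N * 2 ^ n)%N%:Z) j)] = b >])
    (bernoulli_weight (rho lam n) b)%:E)%E.
Proof.
move=> lA; rewrite (local_event_preimage _ lA) /=.
set K := (N * 2 ^ n)%N.
pose v w := [ffun j : {ffun 'I_d -> 'I_(K + K)} => occ delta (X w) n
  (offset_cell (- const_mx K%:Z - z *+ 2 ^ n) j)].
have mv b : measurable (v @^-1` [set b]).
  rewrite (_ : _ @^-1` _ = \bigcap_(j in [set: {ffun 'I_d -> 'I_(K + K)}])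
     [set w | occ delta (X w) n (offset_cell (- const_mx K%:Z - z *+ 2 ^ n) j) = b j]).
    apply: fin_bigcap_measurable => // j _; case: (b j).
      exact: measurable_preimage_occ.
    rewrite (_ : [set _ | _] = ~` [set w | occ delta (X w) n (offset_cell (- const_mx K%:Z - z *+ 2 ^ n) j)]).
      by apply: measurableC; exact: measurable_preimage_occ.
    by apply/seteqP; split => w /=; [move=> ->|move=> /negP/negbTE].
  apply/seteqP; split => w /=; first by move=> <- j _; rewrite ffunE.
  by move=> H; apply/ffunP => j; rewrite ffunE; exact: H.
have := measure_fin_valued Pr (fun b => `[< exists2 mu, A mu & [ffun j => occ delta mu n
      (offset_cell (- const_mx K%:Z) j)] = b >]) mv.
rewrite /v => ->; apply: eq_bigr => b _.
by apply: occ_law; exact: offset_cell_inj.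
Qed.

(** On local events the translates by [z] and by 0 have equal probability by [local_law]; a Dynkin
    induction extends this to all events. *)
Lemma law_translate (z : 'rV[int]_d) (A : set M) : measurable A ->
  Pr (X @^-1` (translate (shift delta z) @^-1` A)) = Pr (X @^-1` A).
Proof.
move=> mA.
have mXA B : measurable B -> measurable (X @^-1` B).
  by move=> mB; have := mX measurableT mB; rewrite setTI.
have mtA B : measurable B -> measurable (translate (shift delta z) @^-1` B : set M).
  by move=> mB; have := measurable_translate (shift delta z) measurableT mB; rewrite setTI.
have gen := local_event_generate d delta_gt0.
pose t := translate (d := d) (shift delta z).
pose same_law (B : set M) := Pr (X @^-1` (t @^-1` B)) = Pr (X @^-1` B).
have sameT : same_law setT by [].
have sameG B : local_event delta B -> same_law B.
  move=> [mB [n [N lB]]]; rewrite /same_law (local_law z lB) -(local_law 0 lB).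
  congr (Pr _); apply/seteqP; split => w /=; rewrite (_ : translate _ _ = X w)//;
    by apply: point_measure_eq => C; rewrite translateE /pushforward;
       congr (X w _); apply/seteqP; split => x /=;
       rewrite (_ : shift delta 0 = 0) ?addr0//; apply/rowP => i; rewrite !mxE mul0r.
have sameC B : measurable B -> same_law B -> same_law (~` B).
  move=> mB PB; rewrite /same_law.
  have := probability_setC Pr (mXA _ mB).
  have := probability_setC Pr (mXA _ (mtA _ mB)).
  rewrite -/t PB => <- /esym E; exact: E.
have sameU (F : (set M)^nat) : (forall n, measurable (F n)) -> trivIset setT F ->
    (forall n, same_law (F n)) -> same_law (\bigcup_k F k).
  move=> mF tF PF; rewrite /same_law !preimage_bigcup.
  have t1 : trivIset setT (fun i => X @^-1` F i).
    by move=> i j _ _ [w [iw jw]]; apply: tF => //; exists (X w).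
  have t2 : trivIset setT (fun i => X @^-1` (t @^-1` F i)).
    by move=> i j _ _ [w [iw jw]]; apply: tF => //; exists (t (X w)).
  rewrite (measure_bigcup _ _ _ (fun i _ => mXA _ (mF i)) t1).
  rewrite (measure_bigcup _ _ _ (fun i _ => mXA _ (mtA _ (mF i))) t2).
  by apply: eq_eseriesr => i _; exact: PF.
apply: (dynkin_induction gen (@local_eventI _ _ _ delta_gt0) sameT sameG sameC sameU).
by rewrite -gen.
Qed.

End poisson_law.

(** * Equivariant thickenings *)

Section thickening.
Context {R : realType} (d : nat) (lam lam' delta : R).
Local Notation M := (point_measure R d).
Context (dd : measure_display) (Omega : measurableType dd)
  (Pr : probability Omega R) (X : Omega -> M) (phi : M -> M).
Hypotheses (delta_gt0 : 0 < delta) (delta_le1 : delta <= 1).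
Hypotheses (lam_gt0 : 0 < lam) (lam_lt : lam < lam').
Hypotheses (mX : measurable_fun setT X) (mphi : measurable_fun setT phi).
Hypothesis X_poisson : homogeneous_poisson Pr lam X.
Hypothesis Y_poisson : homogeneous_poisson Pr lam' (phi \o X).
Hypothesis phi_equivariant : translation_equivariant phi.
Hypothesis phi_ge : forall mu : M, Defs.le_measure mu (phi mu).

Let q := delta ^+ d.
Let p := expR (- (lam * q)) - expR (- (lam' * q)).
Let lam'_gt0 : 0 < lam'. Proof. exact: lt_trans lam_lt. Qed.
Let q_gt0 : 0 < q. Proof. exact: exprn_gt0. Qed.
Let mY : measurable_fun setT (phi \o X). Proof. exact: measurableT_comp. Qed.

Let occ_phi (mu : M) n m : occ delta mu n m -> occ delta (phi mu) n m.
Proof.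
rewrite /occ; apply: contraNN => /eqP H; rewrite -measure_le0 -H.
by apply: phi_ge; exact: measurable_dcell.
Qed.

Definition new_at (z : 'rV[int]_d) : set M :=
  [set mu | ~~ occ delta mu 0 z && occ delta (phi mu) 0 z].

Lemma measurable_new_at z : measurable (new_at z).
Proof.
rewrite (_ : new_at z = ~` [set mu : M | occ delta mu 0 z] `&`
    (phi @^-1` [set mu : M | occ delta mu 0 z])).
  apply: measurableI; first by apply: measurableC; exact: measurable_occ.
  by rewrite -[X in measurable X]setTI; apply: mphi => //; exact: measurable_occ.
by apply/seteqP; split => mu /=; [move=> /andP[/negP]|move=> [/negP n0 o]; apply/andP].
Qed.

Let mXA A : measurable A -> measurable (X @^-1` A).
Proof. by move=> mA; have := mX measurableT mA; rewrite setTI. Qed.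

(** Equivariance of [phi] enters here: translating by [- z] blocks brings block [z] to the origin
    for the input and the output at once. *)
Lemma new_at_translate z (mu : M) :
  new_at 0 (translate (shift delta (- z)) mu) <-> new_at z mu.
Proof.
by rewrite /new_at /= -phi_equivariant !occ_translate// expn0 mulr1n opprK add0r.
Qed.

(** As X <= phi X, a block empty for the output is empty for the input. Newness is thus a difference
    of nested void events, with probabilities given by [void_probability]. *)
Lemma new_at_probability : fine (Pr (X @^-1` new_at 0)) = p.
Proof.
have s0 : side delta 0 = delta by rewrite /side expn0 divr1.
pose V (Z : Omega -> M) := [set w | Z w (dcell delta 0 0) = 0%E].
have mV (Z : Omega -> M) : measurable_fun setT Z -> measurable (V Z).
  move=> mZ; rewrite (_ : V Z = ~` [set w | occ delta (Z w) 0 0]).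
    by apply: measurableC; exact: measurable_preimage_occ.
  by apply/seteqP; split => w; rewrite /V /occ /=; [move=> ->; rewrite eqxx|move=> /negP/negPn/eqP].
rewrite (_ : _ @^-1` _ = V X `\` V (phi \o X)); last first.
  apply/seteqP; split => w; rewrite /V /new_at /occ /=.
    by move=> /andP[/negPn/eqP ? /eqP ?].
  by move=> [-> /eqP ->]; rewrite eqxx.
have YX : V X `&` V (phi \o X) = V (phi \o X).
  apply/setIidPr => w; rewrite /V /= => H; apply/eqP; rewrite -measure_le0 -H.
  by apply: phi_ge; exact: measurable_dcell.
have -> : Pr (V X `\` V (phi \o X)) = (Pr (V X) - Pr (V (phi \o X)))%E.
  rewrite measureD ?YX; [by []|exact: mV|exact: mV|].
  by rewrite (le_lt_trans (probability_le1 _ (mV _ mX))) ?ltry.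
have v1 : Pr (V X) = _ := void_probability delta_gt0 lam_gt0 X_poisson 0 0.
have v2 : Pr (V (phi \o X)) = _ := void_probability delta_gt0 lam'_gt0 Y_poisson 0 0.
rewrite v1 v2 -EFinB /= /rho s0.
by rewrite !subKr.
Qed.

(** If [A] predicts newness of block 0 with error [eta], then by stationarity its translate predicts
    newness of block [z] equally well. The two bounds control how often a prediction is made and how
    often it is correct. *)
Lemma translate_approx (A : set M) (eta : R) z : measurable A ->
  fine (Pr (X @^-1` symdiff (new_at 0) A)) <= eta ->
  let B := X @^-1` (translate (shift delta (- z)) @^-1` A) in
  fine (Pr B) <= p + eta /\ p - eta <= fine (Pr (X @^-1` new_at z `&` B)).
Proof.
move=> mA eA B; have mE := measurable_new_at 0.
have mD : measurable (symdiff (new_at 0) A).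
  by apply: measurableU; exact: measurableD.
rewrite /B (law_translate delta_gt0 lam_gt0 mX X_poisson)//.
rewrite (_ : _ `&` _ = X @^-1` (translate (shift delta (- z)) @^-1` (new_at 0 `&` A))); last first.
  by apply/seteqP; split => w [nw Aw]; split => //; apply/new_at_translate.
rewrite (law_translate delta_gt0 lam_gt0 mX X_poisson); last exact: measurableI.
rewrite -new_at_probability lerBlDr; split.
  apply: (@le_trans _ _ (fine (Pr (X @^-1` new_at 0)) + fine (Pr (X @^-1` symdiff (new_at 0) A)))).
    apply: fine_le_setU; [exact: mXA|exact: mXA|exact: mXA|] => w Aw.
    by have [?|?] := pselect (new_at 0 (X w)); [left|right; right].
  by rewrite lerD2l.
apply: (@le_trans _ _ (fine (Pr (X @^-1` (new_at 0 `&` A))) + fine (Pr (X @^-1` symdiff (new_at 0) A)))).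
  apply: fine_le_setU; [exact: mXA|exact/mXA/measurableI|exact: mXA|] => w Ew.
  by have [?|?] := pselect (A (X w)); [left|right; left].
by rewrite lerD2l.
Qed.

Lemma preimage_approx (E : set M) (e : R) : measurable E -> 0 < e ->
  exists2 A, local_event delta A & fine (Pr (X @^-1` symdiff E A)) <= e.
Proof.
move=> mE e0; pose X' : {RV Pr >-> M} := mfun_Sub (mem_set mX).
have G0 : local_event delta (set0 : set M).
  by split; [exact: measurable0|exists 0%N, 0%N].
have [A GA PA] := measurable_approx (distribution Pr X') (@local_eventC _ d delta)
  (local_eventI delta_gt0) G0 (local_event_generate d delta_gt0) mE e0.
exists A => //; rewrite -lee_fin fineK//.
by apply: fin_num_measure; apply: mXA; case: GA => mA _;
   apply: measurableU; exact: measurableD.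
Qed.

(* The box has 3N blocks per side; predictions are made only for the middle
   N^d blocks, whose windows stay inside the box. *)
Section window.
Variables (n N : nat) (A : set M) (eta : R).
Hypotheses (N_gt0 : (0 < N)%N) (mA : measurable A) (lA : local_at delta n N A).
Hypothesis (A_eta : fine (Pr (X @^-1` symdiff (new_at 0) A)) <= eta).

Local Notation K := (2 ^ n)%N.
Local Notation Z := {ffun 'I_d -> 'I_(3 * N)}.
Local Notation J := {ffun 'I_d -> 'I_K}.

Let block (z : Z) : 'rV[int]_d := \row_i (z i : nat)%:Z.
Let fine_cell (c : Z * J) : 'rV[int]_d := subcell (block c.1) c.2.
Let x (mu : M) : {ffun Z * J -> bool} := [ffun c => occ delta mu n (fine_cell c)].
Let interior_ltn (i : 'I_N) : (N + i < 3 * N)%N.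
Proof. by have := ltn_ord i; lia. Qed.
Let embed (z : {ffun 'I_d -> 'I_N}) : Z := [ffun i => Ordinal (interior_ltn (z i))].
Let shifted (z : Z) : set M := translate (shift delta (- block z)) @^-1` A.
(** The existential makes the prediction a function of the pattern alone; by [wE], on the middle
    blocks the choice of the configuration [mu] does not matter. *)
Let w (a : {ffun Z * J -> bool}) (c : Z * J) : bool :=
  (c.1 \in codom embed) && `[< exists2 mu, shifted c.1 mu & x mu = a >].

Let embed_inj : injective embed.
Proof.
move=> z z' /ffunP e; apply/ffunP => i; apply/val_inj.
by have := congr1 val (e i); rewrite !ffunE /= => /addnI.
Qed.

Let K_gt0 : (0 < K)%N. Proof. by rewrite expn_gt0. Qed.

Let fine_cell_inj : injective fine_cell.
Proof.
have key (a b j k k' : nat) : (j < k)%N -> (k' < k)%N ->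
    a%:Z * k%:Z + j%:Z = b%:Z * k%:Z + k'%:Z -> a = b /\ j = k'.
  move=> jk kk; rewrite -!PoszM -!PoszD => -[] e.
  have := congr1 (divn^~ k) e; rewrite /= !divnMDl ?(leq_ltn_trans _ jk)//.
  rewrite !divn_small// !addn0 => ab; split => //; move: e.
  by rewrite ab => /addnI.
move=> [z j] [z' j'] /rowP e.
have H i : z i = z' i /\ j i = j' i.
  have := e i; rewrite !mxE /= => /(key _ _ _ _ _ (ltn_ord (j i)) (ltn_ord (j' i))).
  by move=> [? ?]; split; apply/val_inj.
by congr pair; apply/ffunP => i; have [] := H i.
Qed.

(** The window reaches N blocks on either side of a middle block, whose coordinates lie in [N, 2N),
    so it stays inside [0, 3N) and the pattern decides the shifted event. *)
Let wE (z : {ffun 'I_d -> 'I_N}) (j : J) mu : w (x mu) (embed z, j) = `[< shifted (embed z) mu >].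
Proof.
rewrite /w /= codom_f /=; apply/asboolP/asboolP => [[nu Anu xE]|Amu]; last by exists mu.
apply: lA Anu => m mW; rewrite !occ_translate//.
set k := m - _.
have kK i : 0 <= k ord0 i < (3 * N * K)%N%:Z.
  have key (a b c : nat) (e : int) : (c < a)%N -> - (a * b)%N%:Z <= e < (a * b)%N%:Z ->
    0 <= e + (a + c)%N%:Z *+ b < (3 * a * b)%N%:Z.
    by move=> ca; rewrite -mulr_natr natz; nia.
  have := key _ K _ _ (ltn_ord (z i)) (mW i).
  by rewrite /k mulNrn opprK !mxE mulmxnE mxE ffunE.
clearbody k.
have key2 (e : int) (a : nat) : 0 <= e < a%:Z -> (`|e| < a)%N by lia.
have key3 (e : int) (a : nat) : 0 <= e < a%:Z -> e = `|e|%N%:Z by lia.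
have kz i : (`|k ord0 i| %/ K < 3 * N)%N.
  rewrite ltn_divLR//; exact: key2 (kK i).
have kj i : (`|k ord0 i| %% K < K)%N by rewrite ltn_mod.
(* Euclidean division by 2^n splits a fine index into its block and its position in the block. *)
have -> : k = fine_cell ([ffun i => Ordinal (kz i)], [ffun i => Ordinal (kj i)]).
  apply/rowP => i; rewrite !mxE /= !ffunE /= -PoszM -PoszD -divn_eq.
  exact: key3 (kK i).
by have := congr1 (fun f : {ffun Z * J -> bool} => f ([ffun i => Ordinal (kz i)], [ffun i => Ordinal (kj i)])) xE; rewrite !ffunE.
Qed.

Let r := rho d delta lam' n.

(** From 1 - e^(- u) <= u, summed over the 2^(n d) fine cells of a block. *)
Let r_card : r * (K ^ d)%:R <= lam' * q.
Proof.
have : r <= lam' * side delta n ^+ d.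
  by rewrite /r /rho lerBlDl -lerBlDr expR_ge1Dx.
rewrite /side expr_div_n mulrA (natrX _ K d) -ler_pdivlMr//.
Qed.

Let mx c : measurable [set o | x (X o) c].
Proof.
rewrite (_ : [set _ | _] = [set o | occ delta (X o) n (fine_cell c)]).
  exact: measurable_preimage_occ.
by apply/seteqP; split => o /=; rewrite ffunE.
Qed.

Let my c : measurable [set o | x (phi (X o)) c].
Proof.
rewrite (_ : [set _ | _] = [set o | occ delta ((phi \o X) o) n (fine_cell c)]).
  exact: measurable_preimage_occ.
by apply/seteqP; split => o /=; rewrite ffunE.
Qed.

Let xy o c : x (X o) c -> x (phi (X o)) c.
Proof. by rewrite !ffunE; exact: occ_phi. Qed.

Let wXE z j : [set o | w (x (X o)) (embed z, j)] = X @^-1` shifted (embed z).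
Proof.
by apply/seteqP; split => o /=; rewrite wE => /asboolP.
Qed.

(** In a new block every fine cell is empty for X and at least one is occupied for phi X, so a
    correct prediction of the block scores in at least one of its cells. *)
Let new_cover (z : {ffun 'I_d -> 'I_N}) :
  X @^-1` new_at (block (embed z)) `&` X @^-1` shifted (embed z) `<=`
  \bigcup_(j in [set: J]) [set o | [&& ~~ x (X o) (embed z, j),
     x (phi (X o)) (embed z, j) & w (x (X o)) (embed z, j)]].
Proof.
move=> o [/andP[]]; rewrite !(occ_refine delta_gt0 _ 0 _ n).
move=> /existsPn xo /existsP[j yo] so; exists j => //=.
by rewrite wE asboolT// !ffunE xo yo.
Qed.

(** [probability_domination] is applied to the fine cells of the box with t = 1 / q. Each of the N^d
    middle blocks contributes at least the left-hand side, the other blocks contribute 0, and the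
    box has 3^d N^d blocks, whence the factor 3^d after division by N^d. *)
Lemma thickening_window :
  ln q^-1 * (p - eta) - lam' * (p + eta) <= (3 ^ d)%:R * (lam' * q).
Proof.
have r01 : 0 <= r <= 1 by exact: rho01.
have t1 : 1 <= q^-1 by rewrite invf_ge1// exprn_ile1// ltW.
have ylaw b : Pr [set o | x (phi (X o)) = b] = (bernoulli_weight r b)%:E.
  exact: (occ_law delta_gt0 lam'_gt0 mY Y_poisson _ _ fine_cell_inj).
have := @probability_domination _ _ _ Pr _ r q^-1 w (x \o X) (x \o (phi \o X))
  r01 t1 mx my xy ylaw.
set T := fun c : Z * J => ln q^-1 * fine (Pr [set o | [&& ~~ x (X o) c,
  x (phi (X o)) c & w (x (X o)) c]]) - q^-1 * r * fine (Pr [set o | w (x (X o)) c]).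
rewrite -[X in X <= _]/(\sum_c T c) => bound.
pose D := ln q^-1 * (p - eta) - lam' * (p + eta).
have T0 z j : z \notin codom embed -> T (z, j) = 0.
  move=> zi; rewrite /T.
  have w0 a : w a (z, j) = false by rewrite /w /= (negbTE zi).
  rewrite [X in Pr X](_ : _ = set0); last first.
    by apply/seteqP; split => // o /=; rewrite w0 !andbF.
  rewrite [X in _ - _ * fine (Pr X)](_ : _ = set0); last first.
    by apply/seteqP; split => // o /=; rewrite w0.
  by rewrite measure0 !mulr0 subr0.
have TD z : z \in codom embed -> D <= \sum_j T (z, j).
  move=> /codomP[z' ->]; rewrite /T sumrB -mulr_sumr lerB//.
    rewrite ler_wpM2l ?ln_ge0//.
    have [_ /le_trans] := translate_approx (block (embed z')) mA A_eta.
    apply; apply: fine_le_sum_cover; last exact: new_cover.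
      apply: measurableI; apply: mXA; first exact: measurable_new_at.
      by have := measurable_translate (shift delta (- block (embed z'))) measurableT mA; rewrite setTI.
    move=> j; exact: (measurable_ffun_pred mx my (fun ab => [&& ~~ ab.1 (embed z', j),
      ab.2 (embed z', j) & w ab.1 (embed z', j)])).
  (* All fine cells of a block carry the same prediction. With t = 1 / q the penalty of a predicted
     block is at most lam', by [r_card]. *)
  under eq_bigr do rewrite wXE.
  rewrite sumr_const card_ffun !card_ord -mulr_natl mulrA.
  have [PA _] := translate_approx (block (embed z')) mA A_eta.
  apply: ler_pM PA; [|by rewrite fine_ge0|].
    by case/andP: r01 => r0 _; rewrite !mulr_ge0// invr_ge0 ltW.
  by rewrite mulrCA mulrC ler_pdivrMr// mulrC.
have Nd0 : 0 < (N ^ d)%:R :> R by rewrite ltr0n expn_gt0 N_gt0.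
rewrite -(ler_pM2l Nd0) -/D.
have : (N ^ d)%:R * D <= \sum_c T c.
  rewrite (eq_bigr (fun c => T (c.1, c.2))); last by case.
  rewrite -(pair_bigA _ (fun z j => T (z, j))) /= (bigID (mem (codom embed))) /=.
  rewrite [X in _ <= _ + X]big1 ?addr0; last first.
    by move=> z zi; apply: big1 => j _; exact: T0.
  apply: (@le_trans _ _ (\sum_(z in codom embed) D)); last exact: ler_sum.
  by rewrite sumr_const card_codom// card_ffun !card_ord mulr_natl.
move=> /le_trans /(_ bound) /le_trans; apply.
rewrite card_prod !card_ffun !card_ord.
have -> : ((3 * N) ^ d * K ^ d)%N%:R * r =
    (N ^ d)%:R * ((3 ^ d)%:R * (r * (K ^ d)%:R)) :> R.
  by rewrite expnMn !natrM; move: r (K ^ d)%:R (N ^ d)%:R (3 ^ d)%:R => *; ring.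
by rewrite !ler_wpM2l.
Qed.

End window.

Lemma thickening_bound :
  ln q^-1 * p <= 3 * lam' * p + 2 * (3 ^ d)%:R * (lam' * q).
Proof.
have p0 : 0 < p.
  by rewrite subr_gt0 ltr_expR ltrN2 ltr_pM2r.
have p20 : 0 < p / 2 by rewrite divr_gt0.
(* Doubling [thickening_window] with [eta] equal to [p / 2] gives the constants 3 and 2. The window
   is enlarged from N to N + 1 because N may be 0. *)
have [A [mA [n [N lA]]] eA] := preimage_approx (measurable_new_at 0) p20.
have := thickening_window (ltn0Sn N) mA (local_atW delta_gt0 (leqnn n) (leqnSn N) lA) eA.
rewrite -[2 * _ * _]mulrA.
by move: (ln _) ((3 ^ d)%:R * (lam' * q)) => L B H; lra.
Qed.

End thickening.

(** * Choice of the block size and conclusion *)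

Theorem theorem3 (R : realType) (d : nat) (lambda lambda' : R)
    (d_ge1 : (1 <= d)%N) (lambda_gt0 : 0 < lambda)
    (lambda_lt : lambda < lambda')
    (disp : measure_display) (Omega : measurableType disp)
    (Pr : probability Omega R) (X : {RV Pr >-> point_measure R d})
    (X_poisson : homogeneous_poisson Pr lambda X) :
  ~ exists phi : point_measure R d -> point_measure R d,
      [/\ translation_equivariant phi,
          monotone_map phi,
          measurable_fun setT phi,
          homogeneous_poisson Pr lambda' (phi \o X)
        & strongly_finitary (distribution Pr X) phi].
Proof.
move=> [phi [phi_eq phi_mono mphi Y_poisson _]].
have lambda'_gt0 : 0 < lambda' := lt_trans lambda_gt0 lambda_lt.
have mX : measurable_fun setT X by exact: measurable_funPT.
have mY : measurable_fun setT (phi \o X) by exact: measurableT_comp.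
case: phi_mono => [phi_le|phi_ge].
  (* Thinning: a unit cell empty for X is empty for phi X, yet its void probability e^(- lambda)
     exceeds e^(- lambda'). *)
  have mvoid (Z : Omega -> point_measure R d) : measurable_fun setT Z ->
      measurable [set o | Z o (dcell 1 0 0) = 0%E].
    move=> mZ; rewrite (_ : [set _ | _] = ~` [set o | occ 1 (Z o) 0 0]).
      by apply: measurableC; exact: measurable_preimage_occ.
    by apply/seteqP; split => o; rewrite /occ /=;
      [move=> ->; rewrite eqxx|move=> /negP/negPn/eqP].
  have : (Pr [set o | X o (dcell 1 0 0) = 0] <=
      Pr [set o | (phi \o X) o (dcell 1 0 0) = 0])%E.
    apply: le_measure; rewrite ?inE; [exact: mvoid|exact: mvoid|].
    move=> o /= X0; apply/eqP; rewrite -measure_le0 -X0.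
    by apply: phi_le; exact: measurable_dcell.
  rewrite (void_probability ltr01 lambda_gt0 X_poisson).
  rewrite (void_probability ltr01 lambda'_gt0 Y_poisson).
  rewrite lee_fin !subKr ler_expR lerN2 ler_pM2r; first by rewrite leNgt lambda_lt.
  by rewrite exprn_gt0// side_gt0.
(* For q <= 1 the constant [c] bounds p / q from below. Replacing q by p / c in [thickening_bound]
   gives ln (1/q) p <= B p. *)
pose c := (lambda' - lambda) * expR (- lambda').
have c0 : 0 < c by rewrite mulr_gt0 ?subr_gt0 ?expR_gt0.
pose B := 3 * lambda' + 2 * (3 ^ d)%:R * lambda' / c.
have B0 : 0 < B.
  by rewrite addr_gt0 ?mulr_gt0 ?invr_gt0 ?ltr0n ?expn_gt0.
(* With this side ln (1/q) = d (B + 1), which exceeds B because d >= 1. *)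
pose delta := expR (- (B + 1)).
have delta0 : 0 < delta := expR_gt0 _.
have delta1 : delta <= 1 by rewrite -expR0 ler_expR oppr_le0 ltW// addr_gt0.
have := thickening_bound delta0 delta1 lambda_gt0 lambda_lt mX mphi X_poisson
  Y_poisson phi_eq phi_ge.
set q := delta ^+ d; set p := _ - _.
have q0 : 0 < q by exact: exprn_gt0.
have q1 : q <= 1 by rewrite exprn_ile1// ltW.
have lnq : ln q^-1 = (B + 1) *+ d.
  by rewrite lnV ?posrE// lnXn// expRK mulNrn opprK.
have cp : c * q <= p.
  (* The factorisation separates the gap between the intensities, bounded below by e^u - 1 >= u,
     from a factor that is at least e^(- lambda') for q <= 1. *)
  have -> : p = expR (- (lambda' * q)) * (expR ((lambda' - lambda) * q) - 1).
    rewrite mulrBr mulr1 -expRD /p; congr (expR _ - _).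
    by rewrite mulrBl addrA addNr sub0r.
  have e1 : (lambda' - lambda) * q <= expR ((lambda' - lambda) * q) - 1.
    by rewrite lerBrDl expR_ge1Dx.
  have e2 : expR (- lambda') <= expR (- (lambda' * q)).
    by rewrite ler_expR lerN2 ler_piMr// ltW.
  rewrite /c mulrAC mulrC; apply: ler_pM => //.
  by rewrite mulr_ge0// ?subr_ge0 ltW.
have p0 : 0 < p by rewrite (lt_le_trans _ cp)// mulr_gt0.
have -> : 2 * (3 ^ d)%:R * (lambda' * q) = 2 * (3 ^ d)%:R * lambda' / c * (c * q).
  by rewrite -[RHS]mulrA mulKf ?gt_eqF// mulrA.
rewrite leNgt lnq => /negP; apply.
apply: (@le_lt_trans _ _ (B * p)).
  rewrite /B [leRHS]mulrDl lerD2l ler_wpM2l//.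
  by rewrite !mulr_ge0// ?invr_ge0 ltW.
rewrite ltr_pM2r// (@lt_le_trans _ _ (B + 1))// ?ltrDl//.
by rewrite -[X in _ *+ X](prednK d_ge1) mulrS lerDl mulrn_wge0// ltW// addr_gt0.
Qed.
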